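(* Let $E$ be a finite directed graph, and let $v\in E^0$ be a vertex such that $\beta_v>0$. Suppose the weak*-limit $\varphi=\lim_{\beta\to\beta_v+0}\varphi_{\beta,v}$ exists. Then $\varphi$ is supported in $E^\infty$. For $C\in\pi_{v,\mathrm{mc}}(E)$, let $S_C$ be the set of vertices from which there is a finite path to $C$, let $D=S_C\setminus C$, and let $\chi^C\in\mathbb R^{S_C}$ be the vector defined by $$\chi^C_w=\varphi(p_w)\ \text{ for } w\in C,\qquad \chi^C_D=(e^{\beta_v}I-A_D)^{-1}A_{D,C}\,\chi^C_C .$$ Then $$\varphi=\sum_{C\in\pi_{v,\mathrm{mc}}(E)}\|\chi^C\|_1\,\psi_C .$$ Moreover, for every $C\in\pi_{v,\mathrm{mc}}(E)$ and every $w\in S_C$, $$\chi^C_w=\lim_{\beta\to\beta_v+0}\frac{Z^C_{w,v}(\beta)}{Z_v(\beta)},\qquad\text{where } Z^C_{w,v}(\beta)=\sum_{w'\in C}Z_{w,w'}(\beta)\,Z_{w',v}(\beta).$$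
   Context: Graphs. A directed graph $E=(E^0,E^1,s,r)$ has vertices $E^0$, edges $E^1$, and source and range maps $s,r:E^1\to E^0$; it is finite if $E^0,E^1$ are finite. A finite path of length $|\mu|=n$ is $\mu=e_0\cdots e_{n-1}$ with $e_i\in E^1$ and $r(e_i)=s(e_{i+1})$; vertices are paths of length $0$; $E^*$ is the set of finite paths, and $E^\infty$ is the set of infinite paths $e_0e_1\cdots$ with $r(e_i)=s(e_{i+1})$. $wE^*v$ is the set of finite paths from $w$ to $v$, $E^*v$ the set of finite paths ending at $v$, $vE^1$ the set of edges with source $v$, and $vE^1w$ the set of edges from $v$ to $w$; for sets $S,T$ of vertices, $SE^*T$ denotes the finite paths from a vertex of $S$ to a vertex of $T$ (and similarly with a vertex in place of a set). The strongly connected components (called components) are the classes of $E^0$ under $v\sim w$ iff $vE^*w\ne\emptyset$ and $wE^*v\neq\emptyset$; $\pi(E)$ is the set of components. $A_E=[|vE^1w|]_{v,w\in E^0}$ is the adjacency matrix; $A_{S,T}$ is its $S\times T$ block and $A_S=A_{S,S}$. $\rho(\cdot)$ is the spectral radius. For a vector $\chi$ and a set $S$ of indices, $\chi_S$ is its restriction to $S$. Algebra. The Toeplitz algebra $\mathcal TC^*(E)$ is the universal C*-algebra generated by mutually orthogonal projections $p_v$ ($v\in E^0$) and partial isometries $s_e$ ($e\in E^1$) with $s_e^*s_e=p_{r(e)}$, $(s_es_e^* )(s_fs_f^* )=0$ for $e\ne f$, and $\sum_{e\in vE^1}s_es_e^*\le p_v$. Put $\delta_v=p_v-\sum_{e\in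 vE^1}s_es_e^*$ and $s_\mu=s_{e_0}\cdots s_{e_{n-1}}$ (with $s_v=p_v$ for vertices). KMS states are with respect to the gauge action $\alpha_t(p_v)=p_v$, $\alpha_t(s_e)=e^{it}s_e$ ($t\in\mathbb R$), at inverse temperatures $\beta>0$. A KMS$_\beta$ state (or positive functional) corresponds to a measure on the space of finite and infinite paths and is said to be supported in $E^\infty$ if that measure is supported in $E^\infty$; equivalently, $\varphi(\delta_v)=0$ for all $v\in E^0$. Generating functions and type I states. For $\beta>0$, $Z_{w,v}(\beta)=\sum_{\nu\in wE^*v}e^{-\beta|\nu|}$. The partition function of $v$ is $Z_v(\beta)=\sum_{\nu\in E^*v}e^{-\beta|\nu|}$, and $\beta_v=\inf\{\beta\in\mathbb R: Z_v(\beta)<\infty\}$. For $\beta>0$ with $\beta>\beta_v$, $\varphi_{\beta,v}$ is the extremal type I KMS$_\beta$ state attached to $v$; it is the unique KMS$_\beta$ state with $\varphi_{\beta,v}(p_w)=Z_{w,v}(\beta)/Z_v(\beta)$ for all $w\in E^0$ (explicitly, $\varphi_{\beta,v}(s_\mu s_\nu^* )=0$ if $\mu\neq\nu$ and $\varphi_{\beta,v}(s_\mu s_\mu^* )=e^{-\beta|\mu|}\varphi_{\beta,v}(p_{r(\mu)})$). Type III states. A component $C$ is minimal if $\rho(A_{C'})<\rho(A_C)$ for every component $C'\ne C$ with $C'E^*C\ne\emptyset$. $\pi_{\mathrm{mc}}(E)$ is the set of minimal components with $\rho(A_C)>1$; for such $C$, $\beta_C=\log\rho(A_C)$. A $\beta$-harmonic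 vector of $E$ is $\chi\in\mathbb R^{E^0}$ with nonnegative entries and $A_E\chi=e^\beta\chi$. The map $\varphi\mapsto[\varphi(p_v)]_{v\in E^0}$ is an isomorphism from the cone of KMS$_\beta$ positive functionals supported in $E^\infty$ onto the cone of $\beta$-harmonic vectors. For $C\in\pi_{\mathrm{mc}}(E)$ and $D=S_C\setminus C$, with $S_C$ the set of vertices from which there is a finite path to $C$, $\psi_C$ is the (extremal) KMS$_{\beta_C}$ state supported in $E^\infty$ corresponding to $\tilde\chi/\|\tilde\chi\|_1$, where $\tilde\chi_C$ is a Perron–Frobenius eigenvector of $A_C$, $\tilde\chi_D=(e^{\beta_C}I-A_D)^{-1}A_{D,C}\tilde\chi_C$, and $\tilde\chi$ is $0$ outside $S_C$. Finally $\pi_{v,\mathrm{mc}}(E)=\{C\in\pi_{\mathrm{mc}}(E): CE^*v\ne\emptyset,\ \beta_C=\beta_v\}$.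
   Formalization: In the last claim, Z^C_{w,v}(β) is the sum of e^{-β|ν|} over paths ν from w to v passing through C, each counted once; the printed sum of products counts a path once per visit to C, and with it the limit fails (one vertex, two loops: the ratio diverges while χ^C=1). *)

(* Defs.v *)
From HB Require Import structures.
From mathcomp Require Import all_boot all_order all_algebra complex.
From mathcomp Require Import all_classical all_reals all_analysis.

Set Implicit Arguments.
Unset Strict Implicit.
Unset Printing Implicit Defensive.

Import Order.TTheory GRing.Theory Num.Theory.
Import numFieldNormedType.Exports.

Local Open Scope classical_set_scope.
Local Open Scope ring_scope.

(* Not assumed unital, as required by the universal property below. *)
Record cstar_algebra (R : realType) := CStarAlgebra {
  cstar_car :> completeNormedModType R[i];
  cmul : cstar_car -> cstar_car -> cstar_car;
  star : cstar_car -> cstar_car;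
  cmulA : associative cmul;
  cmulDl : left_distributive cmul +%R;
  cmulDr : right_distributive cmul +%R;
  cmulZl : forall c a b, cmul (c *: a) b = c *: cmul a b;
  cmulZr : forall c a b, cmul a (c *: b) = c *: cmul a b;
  starK : involutive star;
  starD : {morph star : a b / a + b};
  starZ : forall c a, star (c *: a) = (c^*)%C *: star a;
  starM : forall a b, star (cmul a b) = cmul (star b) (star a);
  cnormM : forall a b, `|cmul a b| <= `|a| * `|b|;
  cnorm_star : forall a, `|cmul (star a) a| = `|a| ^+ 2
}.

Declare Scope cstar_scope.
Delimit Scope cstar_scope with A.
Notation "a ** b" := (cmul a b) (at level 40, left associativity) : cstar_scope.
Notation "a ^**" := (star a) (at level 2, format "a ^**") : cstar_scope.
Local Open Scope cstar_scope.

Section CStar.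
Variables (R : realType) (A : cstar_algebra R).

(* The order of the positive elements, which are the c^* c. *)
Definition cle (a b : A) : Prop := exists c : A, b - a = c^** ** c.

Definition projection (a : A) : Prop := a^** = a /\ a ** a = a.

Definition partial_isometry (a : A) : Prop := a ** a^** ** a = a.

Definition closed_star_subalgebra (B : set A) : Prop :=
  [/\ closed B, B 0, (forall c a b, B a -> B b -> B (c *: a + b)),
      (forall a b, B a -> B b -> B (a ** b)) & (forall a, B a -> B a^**)].

Definition star_hom (B : cstar_algebra R) (f : A -> B) : Prop :=
  [/\ linear f, {morph f : a b / a ** b} & {morph f : a / a^**}].

Definition functional := A -> R[i].

Record state (phi : functional) : Prop := {
  state_linear : scalar phi;
  state_pos : forall a, 0 <= phi (a^** ** a);
  state_bounded : forall a, `|phi a| <= `|a|;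
  state_norm : forall M : R, (forall a, `|phi a| <= M%:C%C * `|a|) -> 1 <= M
}.

Definition weak_star_limit (F : set_system R) (phi_ : R -> functional)
    (phi : functional) : Prop :=
  [/\ scalar phi, continuous (phi : A -> R[i]^o) &
      forall a : A, (phi_ b a : R[i]^o) @[b --> F] --> (phi a : R[i]^o)].

(* F is the analytic extension z |-> alpha_z(a) of the orbit of a. *)
Definition entire_extension (alpha : R -> A -> A) (a : A) (F : R[i]^o -> A) :
    Prop :=
  (forall z, derivable F z 1) /\ (forall t : R, F (t%:C)%C = alpha t a).

(* F (0 +i* beta) is alpha_{i beta}(a). *)
Definition kms_state (alpha : R -> A -> A) (beta : R) (phi : functional) :
    Prop :=
  state phi /\
  forall (a : A) (F : R[i]^o -> A), entire_extension alpha a F ->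
    forall b : A, phi (a ** b) = phi (b ** F (0 +i* beta)%C).

End CStar.

Record digraph := Digraph {
  vert : finType;
  edge : finType;
  src : edge -> vert;
  rng : edge -> vert
}.

Section Graph.
Variable E : digraph.
Notation V := (vert E).

Fixpoint walk (w : V) (es : seq (edge E)) : bool :=
  if es is e :: es' then (src e == w) && walk (rng e) es' else true.

(* Finite paths carry their source, so that vertices are the paths with no
   edge. *)
Definition fpath := {mu : V * seq (edge E) | walk mu.1 mu.2}.

Definition psrc (mu : fpath) : V := (val mu).1.
Definition pedges (mu : fpath) : seq (edge E) := (val mu).2.
Definition plen (mu : fpath) : nat := size (pedges mu).
Definition pverts (mu : fpath) : seq V :=
  psrc mu :: map (@rng E) (pedges mu).
Definition prng (mu : fpath) : V := last (psrc mu) (pverts mu).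

Definition wEv (w v : V) : set fpath :=
  [set mu | psrc mu = w /\ prng mu = v].
Definition Ev (v : V) : set fpath := [set mu | prng mu = v].
(* w E^* C E^* v, the finite paths from w to v that pass through C. Each path
   belongs once to this set, whereas sum_(u in C) Z_{w,u} Z_{u,v} counts it as
   many times as it visits C. *)
Definition wECEv (w : V) (C : {set V}) (v : V) : set fpath :=
  [set mu | wEv w v mu /\ exists2 u, u \in pverts mu & u \in C].

Definition infpath :=
  {x : nat -> edge E | forall i, rng (x i) = src (x i.+1)}.

Definition path_space : Type := (fpath + infpath)%type.

Definition cylinder (mu : fpath) : set path_space :=
  [set x | match x with
    | inl nu => psrc nu = psrc mu /\ prefix (pedges mu) (pedges nu)
    | inr y => src (sval y 0%N) = psrc mu /\
               pedges mu = mkseq (sval y) (plen mu)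
    end].

(* Measurable types are pointed in the library; the base point is the vertex
   v0, and plays no role otherwise. *)
Definition path_space_at (v0 : V) : Type := path_space.

HB.instance Definition _ (v0 : V) := gen_eqMixin (path_space_at v0).
HB.instance Definition _ (v0 : V) := gen_choiceMixin (path_space_at v0).
HB.instance Definition _ (v0 : V) := isPointed.Build (path_space_at v0)
  (inl (exist (fun mu : V * seq (edge E) => walk mu.1 mu.2) (v0, [::]) isT)).

Definition cylinders (v0 : V) : set (set (path_space_at v0)) :=
  range cylinder.

Definition finite_paths : set path_space := range inl.

Definition reach (w v : V) : bool := `[< wEv w v !=set0 >].

Definition reach_set (S T : {set V}) : bool :=
  [exists x in S, exists y in T, reach x y].

Definition components : {set {set V}} :=
  equivalence_partition (fun v w => reach v w && reach w v) [set: V].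

Definition upset (C : {set V}) : {set V} :=
  [set w | [exists x in C, reach w x]].

End Graph.

(* Absolute values are taken in R[i], the eigenvalues of a real matrix being
   complex; the spectral radius of the empty matrix is 0. *)
Definition spectral_radius (R : realType) (n : nat) (M : 'M[R]_n) : R :=
  sup [set complex.Re `|z| | z in
    [set z : R[i] | eigenvalue (map_mx (real_complex R) M) z]].

Section Numbers.
Variables (R : realType) (E : digraph).
Notation V := (vert E).

Definition adj (S T : {set V}) : 'M[R]_(#|S|, #|T|) :=
  \matrix_(i, j)
    (#|[set e : edge E | (src e == enum_val i) && (rng e == enum_val j)]|)%:R.

Definition restrict (S : {set V}) (f : V -> R) : 'cV[R]_#|S| :=
  \col_i f (enum_val i).

(* Extension by 0 outside S. *)
Definition extend0 (S : {set V}) (x : 'cV[R]_#|S|) : V -> R :=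
  fun w => \sum_(i < #|S| | enum_val i == w) x i 0.

(* The vector equal to x on C, to (e^beta I - A_D)^-1 A_{D,C} x on
   D = S_C \ C, and to 0 outside S_C. *)
Definition upset_extension (beta : R) (C : {set V}) (x : 'cV[R]_#|C|) :
    V -> R :=
  let D := upset C :\: C in
  fun w => extend0 x w +
    extend0 (invmx ((expR beta)%:M - adj D D) *m adj D C *m x) w.

Definition norm1 (f : V -> R) : R := \sum_(w : V) `|f w|.

Definition pathsum (P : set (fpath E)) (beta : R) : \bar R :=
  \esum_(nu in P) (expR (- beta * (plen nu)%:R))%:E.
Definition Zwv (w v : V) (beta : R) : \bar R := pathsum (wEv w v) beta.
Definition Zv (v : V) (beta : R) : \bar R := pathsum (Ev v) beta.
Definition ZC (C : {set V}) (w v : V) (beta : R) : \bar R :=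
  pathsum (wECEv w C v) beta.

(* If Z_v is finite everywhere, the infimum is -oo in the extended reals and
   this definition gives 0; the two agree when positive. *)
Definition beta_v (v : V) : R := inf [set b : R | (Zv v b < +oo)%E].

Definition rho (C : {set V}) : R := spectral_radius (adj C C).

Definition minimal_component (C : {set V}) : bool :=
  (C \in components E) &&
  [forall C' in components E,
     (C' != C) && reach_set C' C ==> (rho C' < rho C)].

Definition pi_mc : {set {set V}} :=
  [set C | minimal_component C && (1 < rho C)].

Definition beta_C (C : {set V}) : R := ln (rho C).

Definition pi_v_mc (v : V) : {set {set V}} :=
  [set C in pi_mc | reach_set C [set v] && (beta_C C == beta_v v)].

Definition perron_vector (C : {set V}) (x : 'cV[R]_#|C|) : Prop :=
  (forall i, 0 < x i 0) /\ adj C C *m x = rho C *: x.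

End Numbers.

Section Toeplitz.
Variables (R : realType) (E : digraph).
Notation V := (vert E).

Record toeplitz_family (A : cstar_algebra R) (p : V -> A) (s : edge E -> A) :
    Prop := {
  tf_proj : forall v, projection (p v);
  tf_orth : forall v w, v <> w -> p v ** p w = 0;
  tf_isom : forall e, partial_isometry (s e);
  tf_source : forall e, (s e)^** ** s e = p (rng e);
  tf_range : forall e f, e <> f ->
    (s e ** (s e)^**) ** (s f ** (s f)^**) = 0;
  tf_sum : forall v, cle (\sum_(e | src e == v) s e ** (s e)^**) (p v)
}.

Record is_toeplitz_algebra (A : cstar_algebra R) (p : V -> A)
    (s : edge E -> A) : Prop := {
  ta_family : toeplitz_family p s;
  ta_generated : forall B : set A, closed_star_subalgebra B ->
    (forall v, B (p v)) -> (forall e, B (s e)) -> forall a, B a;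
  ta_universal : forall (B : cstar_algebra R) (q : V -> B) (t : edge E -> B),
    toeplitz_family q t ->
    exists f : A -> B, [/\ star_hom f, (forall v, f (p v) = q v) &
                           (forall e, f (s e) = t e)]
}.

Variables (A : cstar_algebra R) (p : V -> A) (s : edge E -> A).

Record gauge_action (alpha : R -> A -> A) : Prop := {
  gauge_hom : forall t, star_hom (alpha t);
  gauge0 : forall a, alpha 0 a = a;
  gaugeD : forall t u a, alpha (t + u) a = alpha t (alpha u a);
  gauge_cont : forall a, continuous (fun t : R => alpha t a);
  gauge_vert : forall t v, alpha t (p v) = p v;
  gauge_edge : forall t e, alpha t (s e) = (cos t +i* sin t)%C *: s e
}.

Definition s_path (mu : fpath E) : A :=
  if pedges mu is e :: es then foldl (fun a f => a ** s f) (s e) es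
  else p (psrc mu).

Local Open Scope ereal_scope.

(* The measure on the path space corresponding to a KMS functional phi is
   determined by its values phi(s_mu s_mu^* ) on the cylinder sets. *)
Definition supported_on_infinite_paths (phi : functional A) : Prop :=
  exists (v0 : V)
    (m : {measure set (g_sigma_algebraType (@cylinders E v0)) -> \bar R}),
    (forall mu : fpath E,
       m (cylinder mu) = (complex.Re (phi (s_path mu ** (s_path mu)^**)))%:E) /\
    m (@finite_paths E) = 0.

Local Close Scope ereal_scope.

Definition type_I_state (alpha : R -> A -> A) (beta : R) (v : V)
    (phi : functional A) : Prop :=
  kms_state alpha beta phi /\
  forall w, phi (p w) = (fine (Zwv w v beta) / fine (Zv v beta))%:C%C.

(* This does not depend on the choice of the Perron-Frobenius eigenvector. *)
Definition type_III_state (alpha : R -> A -> A) (C : {set V})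
    (phi : functional A) : Prop :=
  [/\ kms_state alpha (beta_C R C) phi, supported_on_infinite_paths phi &
      exists x : 'cV[R]_#|C|, perron_vector x /\
        let chi := upset_extension (beta_C R C) x in
        forall w, phi (p w) = (chi w / norm1 chi)%:C%C].

(* The vector chi^C attached to phi, extended by 0 outside S_C. *)
Definition chiC (phi : functional A) (v : V) (C : {set V}) : V -> R :=
  upset_extension (beta_v R v) (restrict C (fun w => complex.Re (phi (p w)))).

End Toeplitz.

(* Main.v *)
Require Import Defs.
From mathcomp Require Import all_boot all_order all_algebra complex.
From mathcomp Require Import all_classical all_reals all_analysis.
From mathcomp Require Import ring lra.
Import Order.TTheory GRing.Theory Num.Theory.
Import numFieldNormedType.Exports.
Import Defs.
Local Open Scope classical_set_scope.
Local Open Scope ring_scope.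

(** Write [lam = expR (beta_v v)], let [A] be the adjacency matrix of the graph,
    acting on functions on the vertices ([push]), and let [chi w = phi (p w)].

    Splitting off the first edge of a path gives
    [e^beta Z_{w,v} = e^beta [w = v] + (A Z_{.,v}) w]. The partition function
    has a pole at [beta_v] ([Zv_beta_v_infty]): if it were finite there, its
    values would form a supersolution of [A z = lam z] that is strict at [v],
    and a perturbation of it would be a supersolution for a slightly smaller
    eigenvalue, so that [Z_v] would be finite below its abscissa of
    convergence. Dividing the recursion by [Z_v] and letting [beta] decrease to
    [beta_v], one obtains [A chi = lam chi] ([limit_harmonic]).

    The decomposition of [chi] is Perron-Frobenius theory, all of which comes
    from one maximum principle ([max_ratio]). A component on which [chi] is
    positive has spectral radius less than [lam] if [A] leads out of it to
    vertices where [chi] is positive. If not, its spectral radius is [lam], and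
    every component above it does lose mass towards it; so it belongs to
    [pi_v_mc]. Hence [chi] restricts to an eigenvector on each [C] in
    [pi_v_mc], and extends from there to a harmonic vector [chi^C]. What
    remains after subtracting all [chi^C] is an eigenvector for [lam] that lives
    on components of smaller spectral radius, so it is 0
    ([harmonic_decomposition]). Since a Perron eigenvector is unique up to a
    scalar, [chi^C] is the vector of [norm1 (chi^C) psi_C].
    Similarly, the generating functions of the paths through [C], divided by
    [Z_v], satisfy in the limit the equations that define [chi^C]
    ([ZC_limit]).

    It remains to see that KMS functionals with the same values on the vertex
    projections are equal ([word_kms_eq0]). The KMS condition applies to the
    generators, since these are eigenvectors of the gauge action with
    exponential eigenvalues. A word in the generators can be rotated and
    shortened until it is a vertex projection, or its degree is not 0 and its
    value is 0. One of the relations, [p (src e) ** s e = s e], is not among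
    the axioms of a Toeplitz family. It is replaced by a weaker statement that
    follows from positivity: a state vanishes on the square of the defect of
    this relation ([state_defect]), so a KMS state vanishes on all words that
    contain the defect ([kms_word_kms]).

    The limit of KMS states is a KMS state ([kms_limit]); the measure of [phi] on
    the path space is the sum of the multiples of the measures of the
    [psi_C] that the decomposition prescribes. *)

Set Implicit Arguments.
Unset Strict Implicit.
Unset Printing Implicit Defensive.

(** * Walks and strongly connected components *)

Section Reach.
Variable E : digraph.
Notation V := (vert E).

Lemma prngE (mu : fpath E) : prng mu = last (psrc mu) (map (@rng E) (pedges mu)).
Proof. by []. Qed.

Lemma reachP (w v : V) :
  reflect (exists2 es, walk w es & last w (map (@rng E) es) = v) (reach w v).
Proof.
apply: (iffP (asboolP _)) => [[[[u es] /= Hes] [<- <-]]|[es Hes <-]].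
  by exists es.
by exists (exist (fun mu : V * seq (edge E) => walk mu.1 mu.2) (w, es) Hes).
Qed.

Lemma walk_cat (w : V) es fs :
  walk w (es ++ fs) = walk w es && walk (last w (map (@rng E) es)) fs.
Proof. by elim: es w => //= e es IH w; rewrite IH andbA. Qed.

Lemma reach_refl (w : V) : reach w w.
Proof. by apply/reachP; exists [::]. Qed.

Lemma reach_trans (w u v : V) : reach w u -> reach u v -> reach w v.
Proof.
move=> /reachP[es He <-] /reachP[fs Hf <-]; apply/reachP.
by exists (es ++ fs); rewrite ?walk_cat ?He// map_cat last_cat.
Qed.

Lemma reach_edge (e : edge E) : reach (src e) (rng e).
Proof. by apply/reachP; exists [:: e] => //=; rewrite eqxx. Qed.

(** Induction along walks, for sets [T] that are closed under edges into [S]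
    only: it suffices that [S] contains the vertices that lie on walks from
    [w] to [u]. *)
Lemma reach_closed (S T : {set V}) (w u : V) :
  {in T, forall w, forall e, src e = w -> rng e \in S -> rng e \in T} ->
  (forall x, reach x u -> reach w x -> x \in S) ->
  w \in T -> reach w u -> u \in T.
Proof.
move=> clT inS wT /reachP[es He]; elim: es w inS wT He => [w _ wT _ <-//|e es IH w inS wT].
move=> /= /andP[/eqP ew He] Hu.
have eu : reach (rng e) u by apply/reachP; exists es.
have we : reach w (rng e) by rewrite -ew; exact: reach_edge.
apply: (IH (rng e)) => //.
- by move=> x xu ex; apply: inS xu (reach_trans we ex).
- by apply: clT ew _ => //; exact: inS.
Qed.

Definition scc (w : V) : {set V} := [set u | reach w u && reach u w].

Lemma sccP (w u : V) : reflect (reach w u /\ reach u w) (u \in scc w).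
Proof. by rewrite finset.in_set; exact: andP. Qed.

Lemma mem_scc (w : V) : w \in scc w.
Proof. by apply/sccP; split; exact: reach_refl. Qed.

Lemma componentsP (C : {set V}) :
  reflect (exists w, C = scc w) (C \in components E).
Proof.
have sccE w : [set y in [set: V]%SET | reach w y && reach y w] = scc w :> {set V}.
  by apply/setP => u; rewrite !finset.in_set.
apply: (iffP imsetP) => [[w _ ->]|[w ->]]; exists w; rewrite ?sccE//.
Qed.

Lemma scc_eq (w u : V) : u \in scc w -> scc u = scc w.
Proof.
move=> /sccP[wu uw]; apply/setP => x; apply/sccP/sccP => -[a b]; split.
- exact: reach_trans wu a.
- exact: reach_trans b uw.
- exact: reach_trans uw a.
- exact: reach_trans b wu.
Qed.

Lemma component_scc (C : {set V}) (w : V) :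
  C \in components E -> w \in C -> C = scc w.
Proof. by move=> /componentsP[u ->] /scc_eq ->. Qed.

Lemma component_reach (C : {set V}) (w u : V) :
  C \in components E -> w \in C -> u \in C -> reach w u.
Proof. by move=> Cc wC; rewrite (component_scc Cc wC) => /sccP[]. Qed.

Lemma reach_setP (S T : {set V}) :
  reflect (exists w u, [/\ w \in S, u \in T & reach w u]) (reach_set S T).
Proof.
apply: (iffP existsP) => [[w /andP[wS /existsP[u /andP[uT r]]]]|[w [u [wS uT r]]]].
  by exists w, u.
by exists w; rewrite wS; apply/existsP; exists u; rewrite uT.
Qed.

Lemma upsetP (C : {set V}) (w : V) :
  reflect (exists2 u, u \in C & reach w u) (w \in upset C).
Proof.
rewrite finset.in_set; apply: (iffP existsP) => [[u /andP[]]|[u uC wu]]; exists u => //.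
by rewrite uC.
Qed.

Lemma sub_upset (C : {set V}) : C \subset upset C.
Proof. by apply/fintype.subsetP => w wC; apply/upsetP; exists w => //; exact: reach_refl. Qed.

(** A walk between two vertices of a component stays in the component. This is
    the form of irreducibility that the maximum principle uses. *)
Lemma component_succ_closed (C T : {set V}) :
  C \in components E -> T \subset C -> (exists w, w \in T) ->
  {in T, forall w, forall e, src e = w -> rng e \in C -> rng e \in T} ->
  T = C.
Proof.
move=> Cc TC [w wT] clT; apply/eqP; rewrite finset.eqEsubset TC; apply/fintype.subsetP => u uC.
have wC := fintype.subsetP TC _ wT.
apply: (reach_closed clT _ wT); last exact: component_reach Cc wC uC.
move=> x xu wx; rewrite (component_scc Cc wC); apply/sccP; split=> //.
exact: reach_trans xu (component_reach Cc uC wC).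
Qed.

End Reach.

(** * The maximum principle for the adjacency operator *)

Section Push.
Variables (R : realType) (E : digraph).
Notation V := (vert E).
Implicit Types (f g h chi : V -> R) (S T C : {set V}).

(** The adjacency matrix of the whole graph, acting on column vectors. Working
    with functions on the vertices avoids indexing blocks by ['I_#|S|] until an
    inverse matrix is needed. *)
Definition push f (w : V) : R := \sum_(e | src e == w) f (rng e).

Definition cutoff S f : V -> R := fun w => if w \in S then f w else 0.

Lemma eq_push f g w : (forall u, f u = g u) -> push f w = push g w.
Proof. by move=> fg; apply: eq_bigr. Qed.

Lemma pushD f g w : push (fun u => f u + g u) w = push f w + push g w.
Proof. exact: big_split. Qed.

Lemma pushZ k f w : push (fun u => k * f u) w = k * push f w.
Proof. by rewrite /push mulr_sumr. Qed.

Lemma pushB f g w : push (fun u => f u - g u) w = push f w - push g w.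
Proof. by rewrite /push sumrB. Qed.

Lemma push_sum (I : finType) (P : pred I) (f : I -> V -> R) w :
  push (fun u => \sum_(i | P i) f i u) w = \sum_(i | P i) push (f i) w.
Proof. exact: exchange_big. Qed.

Lemma le_push f g w : (forall u, f u <= g u) -> push f w <= push g w.
Proof. by move=> fg; apply: ler_sum. Qed.

Lemma push_ge0 f w : (forall u, 0 <= f u) -> 0 <= push f w.
Proof. by move=> f0; apply: sumr_ge0. Qed.

Lemma push_ge f w e : (forall u, 0 <= f u) -> src e = w -> f (rng e) <= push f w.
Proof.
move=> f0 /eqP ew; rewrite /push (bigD1 e)//= lerDl; exact: sumr_ge0.
Qed.

(** Where the ratio [h / chi] of a subsolution to a positive supersolution is
    maximal, say [t], one has
    [t lam chi = lam h <= push h <= t push chi <= t lam chi], so all of these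
    are equalities; the middle one spreads the maximum to all successors. *)
Lemma max_ratio (lam : R) S chi h :
  (exists w, w \in S) ->
  {in S, forall w, 0 < chi w} ->
  {in S, forall w, push (cutoff S chi) w <= lam * chi w} ->
  (forall w, 0 <= h w) -> (forall w, w \notin S -> h w = 0) ->
  {in S, forall w, lam * h w <= push h w} ->
  exists t : R, exists T : {set V},
    [/\ 0 <= t, T \subset S, (exists w, w \in T),
        {in T, forall w, forall e, src e = w -> rng e \in S -> rng e \in T} &
        (forall w, h w <= t * cutoff S chi w) /\
        {in T, forall w, h w = t * chi w /\
           t * push (cutoff S chi) w = t * (lam * chi w)}].
Proof.
move=> [w0 w0S] chi0 chile h0 hS hle.
pose q w := h w / chi w.
(* [m] is a point where the ratio [q] is maximal, and [t] is [q m]. *)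
have [m mS mmax] : exists2 m, m \in S & forall w, w \in S -> q w <= q m.
  by exists [arg max_(w > w0 in S) q w]%O; case: arg_maxP.
have t0 : 0 <= q m by apply: divr_ge0; [exact: h0|apply: ltW; exact: chi0].
have hlt w : h w <= q m * cutoff S chi w.
  rewrite /cutoff; case: ifPn => [wS|/hS ->]; last by rewrite mulr0.
  by rewrite -ler_pdivrMr; [exact: mmax|exact: chi0].
have key w : w \in S -> h w = q m * chi w ->
    q m * push (cutoff S chi) w = q m * (lam * chi w) /\
    push (fun u => q m * cutoff S chi u - h u) w = 0.
  move=> wS hw; rewrite pushB pushZ.
  have a : push h w <= q m * push (cutoff S chi) w.
    by rewrite -pushZ; apply: le_push.
  have b := hle w wS; have c := ler_wpM2l t0 (chile w wS).
  rewrite hw in b; lra.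
exists (q m), [set w in S | h w == q m * chi w]; split => //.
- by apply/fintype.subsetP => w; rewrite inE => /andP[].
- exists m; rewrite inE mS /= /q; apply/eqP; rewrite divfK// gt_eqF//; exact: chi0.
- move=> w; rewrite inE => /andP[wS /eqP hw] e ew eS; rewrite inE eS /=.
  have [_] := key w wS hw; rewrite /push => /eqP.
  rewrite psumr_eq0 => [|u _]; last by rewrite subr_ge0.
  move=> /allP /(_ e (mem_index_enum _)); rewrite ew eqxx /= /cutoff eS subr_eq0.
  by rewrite eq_sym.
- split=> // w; rewrite inE => /andP[wS /eqP hw]; split => //.
  by have [] := key w wS hw.
Qed.

(** If the supersolution is strict somewhere on every successor-closed set, the
    maximal ratio can only be 0. *)
Lemma max_principle (lam : R) S chi h :
  {in S, forall w, 0 < chi w} ->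
  {in S, forall w, push (cutoff S chi) w <= lam * chi w} ->
  (forall T : {set V}, T \subset S -> (exists w, w \in T) ->
     {in T, forall w, forall e, src e = w -> rng e \in S -> rng e \in T} ->
     exists2 w, w \in T & push (cutoff S chi) w < lam * chi w) ->
  (forall w, 0 <= h w) -> (forall w, w \notin S -> h w = 0) ->
  {in S, forall w, lam * h w <= push h w} ->
  forall w, h w = 0.
Proof.
move=> chi0 chile strict h0 hS hle w.
have [Sw|/hS//] := boolP (w \in S).
have [t [T [t0 TS Tn Tcl [hlt HT]]]] :=
  @max_ratio lam S chi h (ex_intro _ w Sw) chi0 chile h0 hS hle.
have [u uT lt] := strict T TS Tn Tcl.
have [_ /eqP] := HT u uT; rewrite -subr_eq0 -mulrBr mulf_eq0 subr_eq0 (lt_eqF lt) orbF => /eqP te.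
by apply/eqP; rewrite eq_le h0 andbT; have := hlt w; rewrite te mul0r.
Qed.

End Push.

(** * Spectral radius and eigenvectors *)

(** A singular matrix has a left kernel; the transpose turns it into a right
    kernel, which is what acts on column vectors. *)
Lemma unitmxP_ker (F : fieldType) (n : nat) (M : 'M[F]_n) :
  (M \in unitmx) <-> (forall x : 'cV_n, M *m x = 0 -> x = 0).
Proof.
split=> [uM x Mx|inj]; first by rewrite -(mulKmx uM x) Mx mulmx0.
rewrite -unitmx_tr -row_free_unit -kermx_eq0; apply/eqP/row_matrixP => i.
rewrite row0; apply: trmx_inj; rewrite trmx0; apply: inj.
by apply: trmx_inj; rewrite trmx_mul trmxK trmx0 -row_mul mulmx_ker row0.
Qed.

Lemma eigenvalue_right (F : fieldType) (n : nat) (M : 'M[F]_n) (z : F) :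
  eigenvalue M z <-> exists2 x : 'cV_n, x != 0 & M *m x = z *: x.
Proof.
have -> : eigenvalue M z = ((M - z%:M) \notin unitmx).
  by rewrite /eigenvalue /eigenspace kermx_eq0 row_free_unit.
have E (x : 'cV_n) : (M - z%:M) *m x = 0 <-> M *m x = z *: x.
  rewrite mulmxBl mul_scalar_mx; split=> [/eqP|->]; last exact: subrr.
  by rewrite subr_eq0 => /eqP.
split=> [nu|[x x0 /E Mx]].
  apply: contrapT => nx; move/negP: nu; apply; apply/unitmxP_ker => x /E Mx.
  by apply/eqP/negPn/negP => x0; apply: nx; exists x.
by apply/negP => /unitmxP_ker /(_ _ Mx) /eqP; rewrite (negPf x0).
Qed.

Section SpectralRadius.
Variables (R : realType) (n : nat) (M : 'M[R]_n).
Let Mc := map_mx (real_complex R) M.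

(** The eigenvalues are the finitely many roots of the characteristic
    polynomial, so the supremum that defines the spectral radius is a maximum;
    this is what makes strict bounds on the eigenvalues pass to it. *)
Lemma eigenvalues_seq : exists s : seq R[i], forall z, eigenvalue Mc z = (z \in s).
Proof.
have [rs Hrs] := closed_field_poly_normal (char_poly Mc).
exists rs => z; rewrite eigenvalue_root_char Hrs (monicP (char_poly_monic _)) scale1r.
exact: root_prod_XsubC.
Qed.

Lemma Re_normc (z : R[i]) : (complex.Re `|z|)%:C%C = `|z|.
Proof. by rewrite normc_def. Qed.

Lemma Re_norm_ge0 (z : R[i]) : 0 <= complex.Re `|z|.
Proof. by rewrite normc_def sqrtr_ge0. Qed.

(** The eigenvector is real, but the spectral radius only sees eigenvalues of
    the complexified matrix. *)
Lemma spectral_radius_ge (a : R) (x : 'cV[R]_n) :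
  0 <= a -> x != 0 -> M *m x = a *: x -> a <= spectral_radius M.
Proof.
move=> a0 x0 Mx; have [s Hs] := eigenvalues_seq.
have ev : eigenvalue Mc a%:C%C.
  apply/eigenvalue_right; exists (map_mx (real_complex R) x).
    by rewrite map_mx_eq0.
  by rewrite -map_mxM Mx map_mxZ.
apply: ub_le_sup; last first.
  exists a%:C%C; first exact: ev.
  by rewrite normc_def/= expr0n addr0 sqrtr_sqr ger0_norm.
exists (\big[Num.max/0]_(z <- s) complex.Re `|z|) => _ [z /= ez <-].
by apply: le_bigmax_seq => //; rewrite -Hs.
Qed.

Lemma spectral_radius_le (a : R) : 0 <= a ->
  (forall z, eigenvalue Mc z -> complex.Re `|z| <= a) -> spectral_radius M <= a.
Proof.
move=> a0 H; have [[z ez]|ne] := pselect (exists z, eigenvalue Mc z).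
  apply: ge_sup; first by exists (complex.Re `|z|); exists z.
  by move=> _ [y /= ey <-]; exact: H.
rewrite /spectral_radius (_ : [set _ | _ in _] = set0) ?sup0//.
by apply/seteqP; split => // _ [z /= ez _]; case: ne; exists z.
Qed.

Lemma spectral_radius_lt (a : R) : 0 < a ->
  (forall z, eigenvalue Mc z -> complex.Re `|z| < a) -> spectral_radius M < a.
Proof.
move=> a0 H; have [s Hs] := eigenvalues_seq.
have lt : \big[Num.max/0]_(z <- s) complex.Re `|z| < a.
  by rewrite big_seq; apply: bigmax_lt => // z zs; apply: H; rewrite Hs.
apply: le_lt_trans lt; apply: spectral_radius_le.
  exact: bigmax_ge_id.
by move=> z ez; apply: (@le_bigmax_seq _ _ _ _ _ z xpredT (fun z => complex.Re `|z|)) => //; rewrite -Hs.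
Qed.

(** By the triangle inequality the moduli of the entries of a complex
    eigenvector form a subsolution, to which the maximum principle applies. *)
Lemma eigenvalue_modulus (z : R[i]) : (forall i j, 0 <= M i j) ->
  eigenvalue Mc z ->
  exists h : 'cV[R]_n, [/\ h != 0, (forall i, 0 <= h i 0) &
    forall i, complex.Re `|z| * h i 0 <= (M *m h) i 0].
Proof.
move=> M0 /eigenvalue_right[x x0 Mx].
exists (\col_i complex.Re `|x i 0|); split.
- apply: contra x0 => /eqP/matrixP h0; apply/eqP/matrixP => i j.
  have := h0 i 0; rewrite !mxE ord1 => e.
  by apply/eqP; rewrite -normr_eq0 -Re_normc e.
- by move=> i; rewrite mxE Re_norm_ge0.
- move=> i; rewrite !mxE -lecR rmorphM/= !Re_normc -normrM.
  have -> : z * x i 0 = \sum_j (M i j)%:C%C * x j 0.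
    by have /matrixP/(_ i 0) := Mx; rewrite !mxE => <-; apply: eq_bigr => j _; rewrite !mxE.
  apply: le_trans (ler_norm_sum _ _ _) _; rewrite rmorph_sum; apply: ler_sum => j _.
  by rewrite !mxE rmorphM/= Re_normc normrM (ger0_norm (x := (M i j)%:C%C)) ?ler0c.
Qed.

End SpectralRadius.

(** * Spectral radii of components *)

Section Blocks.
Variables (R : realType) (E : digraph).
Notation V := (vert E).
Implicit Types (f g h chi : V -> R) (S T C : {set V}).

Lemma extend0_val S (x : 'cV[R]_#|S|) i : extend0 x (enum_val i) = x i 0.
Proof.
rewrite /extend0 (eq_bigl (pred1 i)) ?big_pred1_eq// => j /=.
exact: (inj_eq enum_val_inj).
Qed.

Lemma extend0_out S (x : 'cV[R]_#|S|) w : w \notin S -> extend0 x w = 0.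
Proof.
move=> wS; rewrite /extend0 big_pred0// => i; apply: contraNF wS => /eqP <-.
exact: enum_valP.
Qed.

Lemma extend0_rank S (x : 'cV[R]_#|S|) w (wS : w \in S) :
  extend0 x w = x (enum_rank_in wS w) 0.
Proof. by rewrite -[in LHS](enum_rankK_in wS wS) extend0_val. Qed.

Lemma extend0_restrict S f w : extend0 (restrict S f) w = cutoff S f w.
Proof.
rewrite /cutoff; case: ifPn => [wS|]; last exact: extend0_out.
by rewrite (extend0_rank _ wS) mxE enum_rankK_in.
Qed.

(** Translation between blocks of the adjacency matrix and [push]. *)
Lemma adj_mulE S T (x : 'cV[R]_#|T|) i :
  (adj R S T *m x) i 0 = push (extend0 x) (enum_val i).
Proof.
rewrite mxE /push /extend0 (exchange_big_dep xpredT)//=; apply: eq_bigr => j _.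
rewrite mxE sumr_const mulr_natl; congr (_ *+ _); apply: eq_card => e.
apply/idP/idP => [/set_mem /= /andP[a b]|/andP[a b]].
  by rewrite unfold_in /= a eq_sym b.
by apply/mem_set; rewrite /= a eq_sym.
Qed.

Lemma push_cutoff_le S chi w : (forall u, 0 <= chi u) ->
  push (cutoff S chi) w <= push chi w.
Proof. by move=> c0; apply: le_push => u; rewrite /cutoff; case: ifP. Qed.

Lemma push_cutoff_lt S chi e : (forall u, 0 <= chi u) ->
  rng e \notin S -> 0 < chi (rng e) ->
  push (cutoff S chi) (src e) < push chi (src e).
Proof.
move=> c0 eS e0; rewrite -subr_gt0 -pushB.
apply: lt_le_trans (push_ge (e := e) _ erefl) => [|u]; last first.
  by rewrite /cutoff; case: ifP => _; rewrite ?subrr ?subr0.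
by rewrite /= /cutoff (negPf eS) subr0.
Qed.

(** If [z] were an eigenvalue of modulus at least [lam], the moduli of an
    eigenvector would form a subsolution for [lam], which the maximum principle
    forces to be 0. *)
Lemma rho_lt (lam : R) C chi : 0 < lam -> C \in components E ->
  {in C, forall w, 0 < chi w} ->
  {in C, forall w, push (cutoff C chi) w <= lam * chi w} ->
  (exists2 w, w \in C & push (cutoff C chi) w < lam * chi w) ->
  rho R C < lam.
Proof.
move=> lam0 Cc chi0 chile [w0 w0C lt]; apply: spectral_radius_lt => // z.
rewrite ltNge => /eigenvalue_modulus[|h [h0 hge hle]]; first by move=> i j; rewrite mxE.
apply/negP => lamz; have ext0 : forall w, extend0 h w = 0.
  apply: (max_principle chi0 chile).
  - by move=> T TC Tn Tcl; rewrite (component_succ_closed Cc TC Tn Tcl); exists w0.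
  - move=> w; have [wC|wC] := boolP (w \in C); last by rewrite extend0_out.
    by rewrite (extend0_rank _ wC).
  - by move=> w; exact: extend0_out.
  - move=> w wC; rewrite -[in leRHS](enum_rankK_in wC wC) -adj_mulE.
    apply: le_trans (hle _); rewrite (extend0_rank _ wC).
    exact: ler_wpM2r.
case/eqP: h0; apply/matrixP => i j; rewrite ord1 mxE -extend0_val; exact: ext0.
Qed.

(** Replacing [lam] by [lam + eps] makes the inequality strict. *)
Lemma rho_le (lam : R) C chi : 0 < lam -> C \in components E ->
  {in C, forall w, 0 < chi w} ->
  {in C, forall w, push (cutoff C chi) w <= lam * chi w} ->
  rho R C <= lam.
Proof.
move=> lam0 Cc chi0 chile; apply/ler_addgt0Pr => eps eps0; apply: ltW.
have lt w : w \in C -> push (cutoff C chi) w < (lam + eps) * chi w.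
  move=> wC; apply: le_lt_trans (chile w wC) _.
  by rewrite ltr_pM2r ?chi0// ltrDl.
apply: (rho_lt (chi := chi)) => //; first by rewrite addr_gt0.
  by move=> w /lt/ltW.
have /componentsP[w Cw] := Cc.
have wC : w \in C by rewrite Cw mem_scc.
by exists w => //; exact: lt.
Qed.

Lemma rho_ge (lam : R) C f w0 : 0 <= lam -> w0 \in C -> f w0 != 0 ->
  {in C, forall w, push (cutoff C f) w = lam * f w} -> lam <= rho R C.
Proof.
move=> lam0 w0C f0 Hf; apply: (@spectral_radius_ge _ _ _ _ (restrict C f)) => //.
  apply: contra f0 => /eqP f0.
  by have := extend0_restrict C f w0; rewrite /cutoff w0C f0 /extend0 big1 => [<-//|i _]; rewrite mxE.
apply/matrixP => i j; rewrite ord1 adj_mulE (eq_push _ (extend0_restrict C f)).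
by rewrite Hf ?enum_valP// !mxE.
Qed.

(** Among the components on which [f] does not vanish, take one that reaches
    none of the others: there [f] restricts to an eigenvector of the diagonal
    block, so the spectral radius of that block is at least [lam]. *)
Lemma eigenvector_eq0 (lam : R) f : 0 <= lam ->
  (forall w, f w != 0 -> rho R (scc w) < lam) ->
  (forall w, f w != 0 -> {in scc w, forall u, push f u = lam * f u}) ->
  forall w, f w = 0.
Proof.
move=> lam0 small eig w.
(* The induction is on the number of vertices that can be reached. *)
have [n] := ubnP #|[set u | reach w u]%SET|; elim: n w => // n IH w; rewrite ltnS => le.
apply/eqP/negPn/negP => fw; have := small w fw; rewrite ltNge => /negP; apply.
apply: (rho_ge lam0 (mem_scc w) fw) => u uC; rewrite -(eig w fw u uC).
apply: eq_bigr => e /eqP eu; rewrite /cutoff; case: ifPn => // eC.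
have /sccP[wu uw] := uC.
have we : reach w (rng e) by apply: reach_trans wu _; rewrite -eu; exact: reach_edge.
apply/esym/IH; apply: leq_trans le; apply: proper_card; apply/properP; split.
  by apply/fintype.subsetP => x; rewrite !finset.in_set; exact: reach_trans.
exists w; rewrite finset.in_set; first exact: reach_refl.
by apply: contra eC => ew; apply/sccP.
Qed.

End Blocks.

(** * Extension of a vector from a component to the vertices above it *)

Section Extension.
Variables (R : realType) (E : digraph).
Notation V := (vert E).
Implicit Types (f g h chi : V -> R) (S T C : {set V}).

Variables (beta : R) (C : {set V}).
Let lam := expR beta.
Let D := upset C :\: C.
Hypothesis Cc : C \in components E.
Hypothesis Cmin : forall C', C' \in components E -> C' != C ->
  reach_set C' C -> rho R C' < lam.

Lemma upsetD_rho w : w \in D -> rho R (scc w) < lam.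
Proof.
rewrite finset.in_setD => /andP[wC /upsetP[u uC wu]]; apply: Cmin.
- by apply/componentsP; exists w.
- by apply: contra wC => /eqP <-; exact: mem_scc.
- by apply/reach_setP; exists w, u; rewrite mem_scc.
Qed.

Lemma upsetD_scc w u : w \in D -> u \in scc w -> u \in D.
Proof.
rewrite !finset.in_setD => /andP[wC /upsetP[x xC wx]] /sccP[wu uw]; apply/andP; split.
  apply: contra wC => uC; rewrite (component_scc Cc uC); apply/sccP; split => //.
by apply/upsetP; exists x => //; exact: reach_trans uw wx.
Qed.

(** Every component in [D] lies above [C], so it has spectral radius less than
    [lam], and [lam] is not an eigenvalue of the block triangular matrix
    [adj D D]. *)
Lemma upsetD_unit : lam%:M - adj R D D \in unitmx.
Proof.
apply/unitmxP_ker => x; rewrite mulmxBl mul_scalar_mx => /eqP; rewrite subr_eq0 => /eqP Ax.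
have inD w : extend0 x w != 0 -> w \in D.
  by apply: contraR => /extend0_out ->.
have x0 : forall w, extend0 x w = 0.
  apply: (eigenvector_eq0 (lam := lam)); first exact: expR_ge0.
    by move=> w /inD; exact: upsetD_rho.
  move=> w /inD wD u /(upsetD_scc wD) uD.
  by rewrite -[in LHS](enum_rankK_in uD uD) -adj_mulE -Ax mxE (extend0_rank _ uD).
by apply/matrixP => i j; rewrite ord1 mxE -extend0_val.
Qed.

Lemma upset_extension_C (x : 'cV[R]_#|C|) w : w \in C -> upset_extension beta x w = extend0 x w.
Proof.
by move=> wC; rewrite /upset_extension [X in _ + X]extend0_out ?addr0// finset.in_setD wC.
Qed.

Lemma upset_extension_out (x : 'cV[R]_#|C|) w :
  w \notin upset C -> upset_extension beta x w = 0.
Proof.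
move=> wU; rewrite /upset_extension !extend0_out ?addr0//.
  by rewrite finset.in_setD negb_and wU orbT.
by apply: contra wU; apply/fintype.subsetP/sub_upset.
Qed.

Lemma push_upset f w : (forall w, w \notin upset C -> f w = 0) -> w \notin upset C -> push f w = 0.
Proof.
move=> f0 wU; rewrite /push big1// => e /eqP ew; apply: f0; apply: contra wU.
case/upsetP => u uC eu; apply/upsetP; exists u => //.
by apply: reach_trans eu; rewrite -ew; exact: reach_edge.
Qed.

(** There are no edges from [C] to [D]: they would close a cycle through [C]. *)
Lemma push_upset_C f w : (forall w, w \notin upset C -> f w = 0) -> w \in C ->
  push f w = push (cutoff C f) w.
Proof.
move=> f0 wC; apply: eq_bigr => e /eqP ew; rewrite /cutoff; case: ifPn => // eC.
apply: f0; apply: contra eC => /upsetP[u uC eu].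
rewrite (component_scc Cc wC); apply/sccP; split; first by rewrite -ew; exact: reach_edge.
exact: reach_trans eu (component_reach Cc uC wC).
Qed.

Lemma push_upset_extension (x : 'cV[R]_#|C|) w : w \in D ->
  push (upset_extension beta x) w = lam * upset_extension beta x w.
Proof.
move=> wD; rewrite /upset_extension pushD -(enum_rankK_in wD wD) -!adj_mulE.
rewrite extend0_val; set y := invmx _ *m _ *m x; set i := enum_rank_in _ _.
have -> : extend0 x (enum_val i) = 0.
  apply: extend0_out; have := enum_valP i; by rewrite finset.in_setD => /andP[].
rewrite add0r -/D.
have E1 : (lam%:M - adj R D D) *m y = adj R D C *m x.
  by rewrite /y -mulmxA mulKVmx// upsetD_unit.
have /matrixP/(_ i 0) := E1; rewrite mulmxBl mul_scalar_mx => <-.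
by rewrite !mxE subrK.
Qed.

Lemma upset_extensionZ t (x : 'cV[R]_#|C|) w :
  upset_extension beta (t *: x) w = t * upset_extension beta x w.
Proof.
rewrite /upset_extension -scalemxAr mulrDr /extend0 !mulr_sumr.
by congr (_ + _); apply: eq_bigr => i _; rewrite mxE.
Qed.

End Extension.

(** * Harmonic vectors *)

Section Decomposition.
Variables (R : realType) (E : digraph) (v : vert E).
Notation V := (vert E).

Lemma pi_v_mcP (C : {set V}) : reflect
  [/\ C \in components E,
      forall C', C' \in components E -> C' != C -> reach_set C' C -> rho R C' < rho R C,
      1 < rho R C, reach_set C [set v]%SET & beta_C R C = beta_v R v]
  (C \in pi_v_mc R v).
Proof.
rewrite finset.in_set; apply: (iffP andP).
  rewrite finset.in_set => -[/andP[/andP[Cc /forallP Cm] C1] /andP[Cv /eqP Cb]]; split => //.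
  by move=> C' C'c C'C r; have := Cm C'; rewrite C'c C'C r.
move=> [Cc Cm C1 Cv Cb]; rewrite finset.in_set Cv Cb eqxx C1 andbT; split => //.
apply/andP; split => //; apply/forallP => C'; apply/implyP => C'c.
by apply/implyP => /andP[]; exact: Cm.
Qed.

Lemma pi_v_mc_rho C : C \in pi_v_mc R v -> rho R C = expR (beta_v R v).
Proof.
move=> /pi_v_mcP[_ _ C1 _ <-]; rewrite lnK// posrE; exact: lt_trans C1.
Qed.

Lemma pi_v_mc_min C : C \in pi_v_mc R v ->
  forall C', C' \in components E -> C' != C ->
  reach_set C' C -> rho R C' < expR (beta_v R v).
Proof. by move=> Cp; have /pi_v_mcP[_ Cm _ _ _] := Cp; rewrite -(pi_v_mc_rho Cp). Qed.

Variable chi : V -> R.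
Let lam := expR (beta_v R v).
Hypothesis lam1 : 1 < lam.
Hypothesis chi_ge0 : forall w, 0 <= chi w.
Hypothesis chi_harm : forall w, push chi w = lam * chi w.
Hypothesis chi_supp : forall w, chi w != 0 -> reach w v.

Let lam0 : 0 < lam. Proof. exact: expR_gt0. Qed.

Lemma harmonic_pos w u : reach w u -> 0 < chi u -> 0 < chi w.
Proof.
move=> /reachP[es]; elim: es w => [w _ /= ->//|e es IH w /= /andP[/eqP ew He] Hu u0].
have e0 := IH _ He Hu u0; rewrite -(pmulr_rgt0 _ lam0) -chi_harm.
exact: lt_le_trans e0 (push_ge chi_ge0 ew).
Qed.

Lemma harmonic_component C w0 : C \in components E -> w0 \in C -> 0 < chi w0 ->
  {in C, forall w, 0 < chi w}.
Proof.
by move=> Cc w0C c0 w wC; apply: harmonic_pos c0; exact: component_reach Cc wC w0C.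
Qed.

Lemma harmonic_component_le (C : {set V}) : {in C, forall w, push (cutoff C chi) w <= lam * chi w}.
Proof. by move=> w _; rewrite -chi_harm; exact: push_cutoff_le. Qed.

(** If nothing escapes from [C], then [chi] restricts to a positive eigenvector
    of [adj C C], whose spectral radius is therefore [lam]. A component above
    [C] contains a vertex with an edge that leaves it towards [C], where [chi]
    is positive; so there something does escape, and the spectral radius is
    less than [lam]. Hence [C] is minimal. *)
Lemma harmonic_component_closed C w0 : C \in components E -> w0 \in C -> 0 < chi w0 ->
  {in C, forall w, push (cutoff C chi) w = lam * chi w} -> C \in pi_v_mc R v.
Proof.
move=> Cc w0C c0 Ceq; have Cpos := harmonic_component Cc w0C c0.
have rhoC : rho R C = lam.
  apply/eqP; rewrite eq_le; apply/andP; split.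
    by apply: (rho_le (chi := chi)) => // w wC; rewrite Ceq.
  by apply: (rho_ge (f := chi) (w0 := w0)) => //; rewrite ?(ltW lam0)// gt_eqF.
apply/pi_v_mcP; split; rewrite ?rhoC//; last first.
- by rewrite /beta_C rhoC expRK.
- by apply/reach_setP; exists w0, v; rewrite finset.in_set1 eqxx w0C chi_supp// gt_eqF.
move=> C' C'c neq /reach_setP[w' [u [w'C' uC w'u]]].
have C'pos : {in C', forall w, 0 < chi w}.
  apply: (harmonic_component C'c w'C'); exact: harmonic_pos w'u (Cpos u uC).
apply: (rho_lt (chi := chi)) => //; first exact: harmonic_component_le.
apply: contrapT => nostrict; have uC' : u \in C'.
  apply: (reach_closed (S := [set x | reach x u]%SET) _ _ w'C' w'u); last first.
    by move=> x xu _; rewrite finset.in_set.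
  move=> w wC' e ew; rewrite finset.in_set => eu; apply: contrapT => /negP eC'.
  apply: nostrict; exists w => //; rewrite -chi_harm -ew; apply: push_cutoff_lt => //.
  exact: harmonic_pos eu (Cpos u uC).
by move/eqP: neq; rewrite (component_scc C'c uC') (component_scc Cc uC).
Qed.

(** Otherwise nothing escapes from the component of [w], which would then belong
    to [pi_v_mc]. *)
Lemma harmonic_rho_lt w : 0 < chi w -> scc w \notin pi_v_mc R v -> rho R (scc w) < lam.
Proof.
move=> c0 Cp; have Cc : scc w \in components E by apply/componentsP; exists w.
apply: (rho_lt (chi := chi)) => //.
- exact: harmonic_component (mem_scc w) c0.
- exact: harmonic_component_le.
apply: contrapT => nostrict; move/negP: Cp; apply.
apply: (harmonic_component_closed Cc (mem_scc w) c0) => u uC; apply/eqP.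
rewrite eq_le harmonic_component_le//= leNgt; apply/negP => lt.
by apply: nostrict; exists u.
Qed.

(** If something escaped from [C], its spectral radius would be less than
    [lam]. *)
Lemma harmonic_pi C : C \in pi_v_mc R v ->
  {in C, forall w, push (cutoff C chi) w = lam * chi w}.
Proof.
move=> Cp w wC; have /pi_v_mcP[Cc _ _ _ _] := Cp.
apply/eqP; rewrite eq_le harmonic_component_le//= leNgt; apply/negP => lt.
have c0 : 0 < chi w.
  rewrite -(pmulr_rgt0 _ lam0); apply: le_lt_trans lt; apply: push_ge0 => u.
  by rewrite /cutoff; case: ifP.
have : rho R C < lam.
  apply: (rho_lt (chi := chi)) => //; last by exists w.
    exact: harmonic_component wC c0.
  exact: harmonic_component_le.
by rewrite (pi_v_mc_rho Cp) ltxx.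
Qed.

Let chiC C := upset_extension (beta_v R v) (restrict C chi).

(** The difference of the two sides is an eigenvector for [lam]. It vanishes on
    the components in [pi_v_mc], because none of them lies above another one;
    on all other components of its support the spectral radius is less than
    [lam]. So it is 0 by [eigenvector_eq0]. *)
Lemma harmonic_decomposition w :
  chi w = \sum_(C in pi_v_mc R v) chiC C w.
Proof.
apply/eqP; rewrite -subr_eq0; apply/eqP; move: w.
pose g w := chi w - \sum_(C in pi_v_mc R v) chiC C w.
have gpush w : push g w = lam * g w.
  rewrite pushB push_sum chi_harm mulrBr mulr_sumr; congr (_ - _); apply: eq_bigr => C Cp.
  have /pi_v_mcP[Cc _ _ _ _] := Cp; have Cm := pi_v_mc_min Cp.
  have out : forall w, w \notin upset C -> chiC C w = 0 by exact: upset_extension_out.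
  have [wC|wC] := boolP (w \in C).
    rewrite (push_upset_C Cc out wC) /chiC upset_extension_C// extend0_restrict {2}/cutoff wC.
    rewrite -(harmonic_pi Cp wC); apply: eq_push => u; rewrite /cutoff; case: ifP => // uC.
    by rewrite upset_extension_C// extend0_restrict /cutoff uC.
  have [wU|wU] := boolP (w \in upset C); last by rewrite (push_upset out wU) out// mulr0.
  by apply: push_upset_extension => //; rewrite finset.in_setD wC.
have gpi C w : C \in pi_v_mc R v -> w \in C -> g w = 0.
  move=> Cp wC; have /pi_v_mcP[Cc _ _ _ _] := Cp; rewrite /g (bigD1 C)//= big1 ?addr0.
    by rewrite /chiC upset_extension_C// extend0_restrict /cutoff wC subrr.
  move=> C' /andP[C'p neq]; apply: upset_extension_out; apply/negP => /upsetP[u uC' wu].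
  have := pi_v_mc_min C'p Cc; rewrite eq_sym neq (pi_v_mc_rho Cp) ltxx => H.
  by have : false by apply: H => //; apply/reach_setP; exists w, u.
apply: (eigenvector_eq0 (lam := lam)); first exact: expR_ge0; last by move=> w _ u _; exact: gpush.
move=> w gw.
have [Cp|nCp] := boolP (scc w \in pi_v_mc R v).
  by move: gw; rewrite -/(g w) (gpi _ _ Cp (mem_scc w)) eqxx.
have [c0|c0] := eqVneq (chi w) 0; last first.
  by apply: harmonic_rho_lt => //; rewrite lt_neqAle eq_sym c0 chi_ge0.
have /existsP[C /andP[Cp wC]] : [exists C, (C \in pi_v_mc R v) && (chiC C w != 0)].
  apply: contraR gw => /existsPn nC; rewrite c0 sub0r oppr_eq0 big1// => C Cp.
  by have := nC C; rewrite Cp /= negbK => /eqP.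
apply: (upsetD_rho (C := C)); first exact: pi_v_mc_min.
have : w \in upset C by apply: contraR wC => wC; rewrite /chiC upset_extension_out.
rewrite finset.in_setD => ->; rewrite andbT; apply: contra nCp => wCC.
by have /pi_v_mcP[Cc _ _ _ _] := Cp; rewrite -(component_scc Cc wCC).
Qed.

(** The ratio of [chi] to a Perron eigenvector attains its maximum on a
    successor-closed subset of [C], that is, everywhere. *)
Lemma harmonic_perron (C : {set V}) (x : 'cV[R]_#|C|) : C \in pi_v_mc R v -> perron_vector x ->
  exists2 t, 0 <= t & restrict C chi = t *: x.
Proof.
move=> Cp [x0 Ax]; have /pi_v_mcP[Cc _ _ _ _] := Cp.
have xE w : cutoff C (extend0 x) w = extend0 x w.
  by rewrite /cutoff; case: ifPn => // /extend0_out ->.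
have Ax' : {in C, forall w, push (extend0 x) w = lam * extend0 x w}.
  move=> w wC; rewrite -(enum_rankK_in wC wC) -adj_mulE Ax mxE extend0_val.
  by rewrite (pi_v_mc_rho Cp).
have [||||||t [T [t0 TC Tn Tcl [_ HT]]]] := @max_ratio R E lam C (extend0 x) (cutoff C chi).
- by have /componentsP[w Cw] := Cc; exists w; rewrite Cw mem_scc.
- by move=> w wC; rewrite (extend0_rank _ wC).
- by move=> w wC; rewrite (eq_push _ xE) Ax'.
- by move=> w; rewrite /cutoff; case: ifP.
- by move=> w wC; rewrite /cutoff (negPf wC).
- by move=> w wC; rewrite (harmonic_pi Cp wC) /cutoff wC.
have TE := component_succ_closed Cc TC Tn Tcl; exists t => //.
apply/matrixP => i j; rewrite ord1 !mxE.
have iC : enum_val i \in T by rewrite TE enum_valP.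
by have [+ _] := HT _ iC; rewrite /cutoff enum_valP extend0_val.
Qed.

End Decomposition.

(** * Generating functions of paths *)

Lemma esumZ (R : realType) (T : choiceType) (P : set T) (k : R) (a : T -> \bar R) :
  0 < k -> (forall i, 0 <= a i)%E ->
  (\esum_(i in P) (k%:E * a i) = k%:E * \esum_(i in P) a i)%E.
Proof.
move=> k0 a0; rewrite /esum -ereal_sup_pZl// image_comp; congr ereal_sup.
by apply: eq_imagel => F _ /=; rewrite ge0_mule_fsumr.
Qed.

Section PathSums.
Variables (R : realType) (E : digraph).
Notation V := (vert E).
Implicit Types (P Q : set (fpath E)) (beta : R).

Definition mkpath (w : V) es (H : walk w es) : fpath E :=
  exist (fun mu : V * seq (edge E) => walk mu.1 mu.2) (w, es) H.

Lemma fpath_eq (mu nu : fpath E) :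
  psrc mu = psrc nu -> pedges mu = pedges nu -> mu = nu.
Proof.
move=> a b; apply: val_inj; rewrite (surjective_pairing (val mu)).
by rewrite (surjective_pairing (val nu)); congr pair.
Qed.

Lemma fpath_walk (mu : fpath E) : walk (psrc mu) (pedges mu).
Proof. exact: (valP mu). Qed.

Let wgt beta (nu : fpath E) : \bar R := (expR (- beta * (plen nu)%:R))%:E.

Let wgt_ge0 beta nu : (0 <= wgt beta nu)%E.
Proof. by rewrite lee_fin expR_ge0. Qed.

Lemma pathsum_ge0 P beta : (0 <= pathsum P beta)%E.
Proof. exact: esum_ge0. Qed.

Lemma sub_pathsum P Q beta : P `<=` Q -> (pathsum P beta <= pathsum Q beta)%E.
Proof.
move=> PQ; apply: le_ereal_sup => _ [F [Ff FP] <-]; exists F => //.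
by split=> //; exact: subset_trans PQ.
Qed.

Lemma pathsum_anti P beta beta' : beta <= beta' ->
  (pathsum P beta' <= pathsum P beta)%E.
Proof.
move=> le; apply: le_esum => nu _; rewrite lee_fin ler_expR.
by apply: ler_wpM2r => //; rewrite lerN2.
Qed.

Lemma pathsum_ge P beta mu : P mu ->
  ((expR (- beta * (plen mu)%:R))%:E <= pathsum P beta)%E.
Proof.
move=> Pmu; apply: le_trans (@sub_pathsum [set mu] _ beta _); last by move=> _ ->.
by rewrite /pathsum esum_set1// wgt_ge0.
Qed.

Lemma pathsum_partition (I : finType) (p : pred I) (K : I -> set (fpath E)) P beta :
  (forall mu, P mu -> exists i, [/\ p i, K i mu & forall j, p j -> K j mu -> j = i]) ->
  pathsum P beta = (\sum_(i | p i) pathsum (P `&` K i) beta)%E.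
Proof.
move=> HK; rewrite /pathsum.
under [RHS]eq_bigr do rewrite esum_mkcondr.
rewrite -esum_sum; last by move=> mu i _ _; case: ifP.
apply: eq_esum => mu /HK[i [pi Ki uniq]].
rewrite (bigD1 i)//= mem_set// big1 ?adde0// => j /andP[pj ji].
by case: ifP => // /set_mem /(uniq _ pj) /eqP; rewrite (negPf ji).
Qed.

(** Made total by fixing the paths without edges. *)
Definition ptail (mu : fpath E) : fpath E :=
  insubd mu (if pedges mu is e :: es then (rng e, es) else val mu).

Lemma ptail_src mu e es : pedges mu = e :: es -> psrc (ptail mu) = rng e.
Proof.
move=> mue; have := fpath_walk mu; rewrite mue /= => /andP[_ We].
by rewrite /psrc /ptail mue val_insubd /= We.
Qed.

Lemma ptail_edges mu e es : pedges mu = e :: es -> pedges (ptail mu) = es.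
Proof.
move=> mue; have := fpath_walk mu; rewrite mue /= => /andP[_ We].
by rewrite /pedges /ptail mue val_insubd /= We.
Qed.

(** Removing the first edge is a bijection from the paths in [P] that start with
    [e] onto [Q e], and it lowers the length by one. *)
Lemma pathsum_step beta w P (Q : edge E -> set (fpath E)) :
  (forall mu, P mu -> psrc mu = w /\ pedges mu <> [::]) ->
  (forall e nu, Q e nu -> psrc nu = rng e) ->
  (forall mu nu e, src e = w -> psrc mu = w -> psrc nu = rng e ->
     pedges mu = e :: pedges nu -> P mu <-> Q e nu) ->
  ((expR beta)%:E * pathsum P beta = \sum_(e | src e == w) pathsum (Q e) beta)%E.
Proof.
move=> Pw Qe PQ.
rewrite (@pathsum_partition _ (fun e => src e == w) (fun e => [set mu | ohead (pedges mu) = Some e])).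
  rewrite ge0_sume_distrr; last by move=> e _; exact: pathsum_ge0.
  apply: eq_bigr => e /eqP ew; rewrite /pathsum -esumZ ?expR_gt0//.
  rewrite (@reindex_esum _ _ _ (P `&` [set mu | ohead (pedges mu) = Some e]) (Q e) ptail).
    apply: eq_esum => mu [/= _]; case mue: (pedges mu) => [//|f es] _.
    rewrite /plen (ptail_edges mue) mue /= -EFinM -expRD; congr (expR _)%:E.
    by rewrite -natr1; ring.
  split.
  - move=> mu [/= Pmu]; case mue: (pedges mu) => [//|f es] [fe].
    apply/(PQ mu) => //; first by have [] := Pw _ Pmu.
      by rewrite (ptail_src mue) fe.
    by rewrite mue (ptail_edges mue) fe.
  - move=> mu nu /set_mem[/= Pmu mue] /set_mem[/= Pnu nue] eqt.
    move: mue nue eqt; case mue: (pedges mu) => [//|f es] [fe].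
    case nue: (pedges nu) => [//|g fs] [ge] eqt; apply: fpath_eq.
      by have [-> _] := Pw _ Pmu; have [-> _] := Pw _ Pnu.
    by rewrite mue nue fe ge -(ptail_edges mue) -(ptail_edges nue) eqt.
  - move=> nu Qnu /=; have nue := Qe _ _ Qnu.
    have H : walk w (e :: pedges nu) by rewrite /= ew eqxx -nue fpath_walk.
    have tE : ptail (mkpath H) = nu.
      by apply: fpath_eq; [rewrite (@ptail_src _ e (pedges nu))|rewrite (@ptail_edges _ e (pedges nu))].
    exists (mkpath H) => //; by split; [exact/(PQ _ nu e)|exact: erefl].
move=> mu Pmu; have [muw] := Pw _ Pmu; have := fpath_walk mu.
case mue: (pedges mu) => [//|e es] /= /andP[/eqP eu _] _; exists e; split => [||j _]; rewrite /= ?mue ?eu ?muw//.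
by case.
Qed.

Lemma prng_step (mu nu : fpath E) e : psrc nu = rng e ->
  pedges mu = e :: pedges nu -> prng mu = prng nu.
Proof. by move=> nue mue; rewrite !prngE mue /= nue. Qed.

(** The predicate [N] on lengths yields both the recursion for all paths and the
    one for paths of bounded length. *)
Lemma wEv_step (N : pred nat) beta (w v : V) :
  ((expR beta)%:E * pathsum (wEv w v `&` [set mu | N (plen mu)]) beta =
   (if (w == v) && N 0%N then expR beta else 0)%:E +
   \sum_(e | src e == w) pathsum (wEv (rng e) v `&` [set mu | N (plen mu).+1]) beta)%E.
Proof.
set P := _ `&` _; pose T := [set mu : fpath E | pedges mu == [::]].
have -> : pathsum P beta = (pathsum (P `&` T) beta + pathsum (P `&` ~` T) beta)%E.
  by rewrite /pathsum (esumID T)// => mu _; exact: wgt_ge0.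
rewrite ge0_muleDr ?pathsum_ge0//; congr (_ + _)%E; last first.
  apply: pathsum_step.
  - by move=> mu [[[muw _] _] /negP/eqP]; split.
  - by move=> e nu [[]].
  - move=> mu nu e ew muw nue mue; rewrite /P /T /wEv /= mue /= /plen mue /=.
    rewrite (prng_step nue mue) muw nue; by split=> [[[[_ ?] ?] _]|[[_ ?] ?]]; do ?split.
have [wv|wv] := eqVneq w v => /=; last first.
  rewrite (_ : P `&` T = set0) /pathsum ?esum_set0 ?mule0//.
  apply/seteqP; split => // mu [[[muw muv] _] /= /eqP mue].
  by case/eqP: wv; rewrite -muw -muv prngE mue.
have [N0|N0] := ifPn; last first.
  rewrite (_ : P `&` T = set0) /pathsum ?esum_set0 ?mule0//.
  apply/seteqP; split => // mu [[_ /=] + /eqP mue].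
  by rewrite /plen mue /= (negPf N0).
have H : walk w [::] by [].
rewrite (_ : P `&` T = [set mkpath H]) /pathsum ?esum_set1//.
  by rewrite /plen /= mulr0 expR0 mule1.
apply/seteqP; split => [mu [[[muw muv] _] /= /eqP mue]|_ ->].
  by apply: fpath_eq; rewrite ?muw ?mue.
by split => //; split => //; split.
Qed.

Lemma wEv_trunc_full (w v : V) : wEv w v `&` [set mu : fpath E | predT (plen mu)] = wEv w v.
Proof. by rewrite (_ : [set mu | _] = setT) ?setIT//; apply/seteqP; split. Qed.

Lemma Zwv_step beta (w v : V) :
  ((expR beta)%:E * Zwv w v beta =
   (if w == v then expR beta else 0)%:E +
   \sum_(e | src e == w) Zwv (rng e) v beta)%E.
Proof.
have := wEv_step predT beta w v; rewrite wEv_trunc_full andbT => ->.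
by congr (_ + _)%E; apply: eq_bigr => e _; rewrite wEv_trunc_full.
Qed.

(** A path from [w] visits [C] if and only if the rest of the path after its
    first edge does, since [w] is not in [C]. *)
Lemma ZC_step beta (C : {set V}) w v : w \notin C ->
  ((expR beta)%:E * ZC C w v beta = \sum_(e | src e == w) ZC C (rng e) v beta)%E.
Proof.
move=> wC; apply: pathsum_step.
- move=> mu [[muw _] [u uin uC]]; split => // mue; move: uin uC wC.
  by rewrite /pverts mue muw inE => /eqP -> ->.
- by move=> e nu [[]].
- move=> mu nu e ew muw nue mue; rewrite /wECEv /wEv /= (prng_step nue mue) muw nue.
  split=> [[[_ muv] [u]]|[[_ muv] [u]]].
    rewrite /pverts mue muw /= -nue inE => /predU1P[->|uin uC]; first by rewrite (negPf wC).
    by split => //; exists u.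
  by move=> uin uC; split => //; exists u => //; rewrite /pverts mue /= -nue inE uin orbT.
Qed.

Lemma ZC_mem beta (C : {set V}) w v : w \in C -> ZC C w v beta = Zwv w v beta.
Proof.
move=> wC; congr (pathsum _ _); apply/seteqP; split => [mu []//|mu muw]; split => //.
by exists w => //; case: muw => <- _; rewrite /pverts inE eqxx.
Qed.

Lemma ZC_le beta (C : {set V}) w v : (ZC C w v beta <= Zwv w v beta)%E.
Proof. by apply: sub_pathsum => mu []. Qed.

Lemma ZC_out beta (C : {set V}) w v : w \notin upset C -> ZC C w v beta = 0%E.
Proof.
move=> wU; rewrite /ZC (_ : wECEv w C v = set0) /pathsum ?esum_set0//.
apply/seteqP; split => // mu [[muw _] [u uin uC]]; case/negP: wU; apply/upsetP; exists u => //.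
have := fpath_walk mu; rewrite muw; move: uin; rewrite /pverts muw.
elim: (pedges mu) w {muw} => [w|e es IH w] /=; first by rewrite inE => /eqP -> _; exact: reach_refl.
rewrite inE => /predU1P[-> _|uin /andP[/eqP ew We]]; first exact: reach_refl.
by apply: reach_trans (IH _ uin We); rewrite -ew; exact: reach_edge.
Qed.

Lemma Zwv_le beta (w v : V) : (Zwv w v beta <= Zv v beta)%E.
Proof. by apply: sub_pathsum => mu []. Qed.

Lemma Zv_sum beta (v : V) : (Zv v beta = \sum_w Zwv w v beta)%E.
Proof.
rewrite /Zv (@pathsum_partition _ xpredT (fun w => [set mu | psrc mu = w])).
  apply: eq_bigr => w _; congr (pathsum _ _).
  by apply/seteqP; split=> mu [].
by move=> mu _; exists (psrc mu); split => // w _ /= ->.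
Qed.

Lemma Zwv_unreach beta (w v : V) : ~~ reach w v -> Zwv w v beta = 0%E.
Proof.
move=> wv; rewrite /Zwv (_ : wEv w v = set0) /pathsum ?esum_set0//.
by apply/seteqP; split => // mu muw; case/negP: wv; apply/asboolP; exists mu.
Qed.

Lemma Zwv_gt0 beta (w v : V) : reach w v -> (0 < Zwv w v beta)%E.
Proof.
move=> /asboolP[mu muw]; apply: lt_le_trans (pathsum_ge beta muw).
by rewrite lte_fin expR_gt0.
Qed.

(** By induction on the length the paths of bounded length contribute at most
    [h]. *)
Lemma Zwv_le_super beta (v : V) (h : V -> R) : (forall w, 0 <= h w) ->
  (forall w, reach w v ->
     (if w == v then expR beta else 0) + push h w <= expR beta * h w) ->
  forall w, (Zwv w v beta <= (h w)%:E)%E.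
Proof.
move=> h0 hs.
have trunc n w : (pathsum (wEv w v `&` [set mu | (plen mu < n)%N]) beta <= (h w)%:E)%E.
  elim: n w => [|n IH] w.
    rewrite (_ : _ `&` _ = set0) /pathsum ?esum_set0 ?lee_fin//.
    by apply/seteqP; split => // mu [].
  have [wv|wv] := boolP (reach w v); last first.
    apply: le_trans (sub_pathsum _ (@subIsetl _ _ _)) _.
    by have := Zwv_unreach beta wv; rewrite /Zwv => ->; rewrite lee_fin.
  have e0 : (0 < (expR beta)%:E)%E by rewrite lte_fin expR_gt0.
  rewrite -(lee_pmul2l _ e0)// (wEv_step (fun k => (k < n.+1)%N)) andbT -EFinM.
  apply: le_trans (_ : _ <= ((if w == v then expR beta else 0) + push h w)%:E)%E _; last first.
    by rewrite lee_fin; exact: hs.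
  rewrite EFinD leeD2l// /push -sumEFin; apply: lee_sum => e _; exact: IH.
move=> w; apply: ge_ereal_sup => _ [F [Ff FP] <-].
pose n := (\max_(mu <- finmap.enum_fset (fset_set F)) plen mu).+1.
apply: le_trans (trunc n w); apply: ereal_sup_ubound; exists F => //; split => // mu Fmu.
split; first exact: FP; rewrite /= /n ltnS.
by apply: (@leq_bigmax_seq _ _ xpredT (@plen E)) => //; rewrite in_fset_set// mem_set.
Qed.

End PathSums.

(** * The pole of the partition function *)

Section Divergence.
Variables (R : realType) (E : digraph) (v : vert E).
Notation V := (vert E).
Hypothesis hv : 0 < beta_v R v.
Let bv := beta_v R v.
Let lam := expR bv.

Let hasinf : has_inf [set b : R | (Zv v b < +oo)%E].
Proof.
apply: contrapT => /inf_out e; move: hv; by rewrite /beta_v e ltxx.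
Qed.

Lemma Zv_fin (beta : R) : bv < beta -> (Zv v beta < +oo)%E.
Proof.
rewrite -subr_gt0 => /inf_adherent /(_ hasinf)[b /= bfin].
rewrite -/(beta_v R v) -/bv addrC subrK => /ltW /(pathsum_anti (Ev v)) le.
exact: le_lt_trans bfin.
Qed.

Lemma beta_v_le (beta : R) : (Zv v beta < +oo)%E -> bv <= beta.
Proof. by move=> H; apply: inf_lbound => //; case: hasinf. Qed.

Lemma Zwv_fin_num (beta : R) (w : V) : (Zv v beta < +oo)%E -> Zwv w v beta \is a fin_num.
Proof.
move=> H; rewrite ge0_fin_numE ?pathsum_ge0//; apply: le_lt_trans H; exact: Zwv_le.
Qed.

Lemma fine_Zwv_step (beta : R) (w : V) : (Zv v beta < +oo)%E ->
  expR beta * fine (Zwv w v beta) =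
  (if w == v then expR beta else 0) + push (fun u => fine (Zwv u v beta)) w.
Proof.
move=> H; apply/eqP; rewrite -eqe EFinM EFinD fineK ?Zwv_fin_num// Zwv_step.
rewrite /push -sumEFin; apply/eqP; congr (_ + _)%E; apply: eq_bigr => e _.
by rewrite fineK// Zwv_fin_num.
Qed.

(** Finite partial sums are continuous in the inverse temperature. *)
Lemma Zv_at_beta_v (M : R) : (forall beta, bv < beta -> (Zv v beta <= M%:E)%E) ->
  (Zv v bv <= M%:E)%E.
Proof.
move=> H; apply: ge_ereal_sup => _ [F [Ff FP] <-].
rewrite fsbig_finite//= sumEFin lee_fin.
pose f (b : R) := \sum_(nu <- finmap.enum_fset (fset_set F)) expR (- b * (plen nu)%:R).
have fc : f @ bv^'+ --> f bv.
  apply: cvg_at_right_filter; rewrite /f.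
  elim: (finmap.enum_fset _) => [|nu s IH].
    by under eq_fun do rewrite big_nil; rewrite big_nil; exact: cvg_cst.
  under eq_fun do rewrite big_cons; rewrite big_cons; apply: cvgD => //.
  apply: continuous_cvg; first exact: continuous_expR.
  by apply: cvgMl; apply: cvgN; exact: cvg_id.
apply: (cvgr_to_le fc); near=> b.
have vb : bv < b by near: b; exact: nbhs_right_gt.
rewrite -lee_fin; apply: le_trans (H b vb); rewrite /f -sumEFin.
by apply: ereal_sup_ubound; exists F => //; rewrite fsbig_finite.
Unshelve. all: by end_near. Qed.

(** Suppose that [z w = Z_{w,v}(beta_v)] is finite. On the set [S] of vertices
    that reach [v] it is a positive supersolution for [lam], strict at [v], and
    every vertex of [S] reaches [v]; so by the maximum principle [lam] is not
    an eigenvalue of [adj S S], and [lam g - A g = 2 z] has a solution [g] on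
    [S]. For small [eps] the vector [z + eps g] is then nonnegative and a
    supersolution for [lam - eps], because
    [(lam - eps - A) (z + eps g) = lam 1_v + eps (z - eps g)].
    Hence the partition function is finite at [ln (lam - eps)], which lies
    below its abscissa of convergence. *)
Lemma Zv_beta_v_infty : Zv v bv = +oo%E.
Proof.
have [H|] := ltP (Zv v bv) +oo%E; last by rewrite leye_eq => /eqP.
exfalso; pose z w := fine (Zwv w v bv); pose S := [set w | reach w v]%SET.
have lam1 : 1 < lam by rewrite /lam expR_gt1.
have z0 w : 0 <= z w by apply: fine_ge0; exact: pathsum_ge0.
have zS : {in S, forall w, 0 < z w}.
  move=> w; rewrite finset.in_set => wv; apply: fine_gt0.
  by rewrite Zwv_gt0//= -ge0_fin_numE ?pathsum_ge0// Zwv_fin_num.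
have zout w : w \notin S -> z w = 0.
  by rewrite finset.in_set => /Zwv_unreach e; rewrite /z e.
have zstep w : lam * z w = (if w == v then lam else 0) + push z w by exact: fine_Zwv_step.
have zcut w : cutoff S z w = z w.
  by rewrite /cutoff; case: ifPn => // /zout ->.
have vS : v \in S by rewrite finset.in_set reach_refl.
have Sunit : lam%:M - adj R S S \in unitmx.
  apply/unitmxP_ker => x; rewrite mulmxBl mul_scalar_mx => /eqP; rewrite subr_eq0 => /eqP Ax.
  have x0 : forall w, `|extend0 x w| = 0.
    apply: (@max_principle _ _ lam S z) => //.
    - by move=> w wS; rewrite (eq_push _ zcut) zstep lerDr; case: ifP => // _; rewrite ltW// (lt_trans _ lam1).
    - move=> T TS [w wT] Tcl; exists v; last first.
        by rewrite (eq_push _ zcut) zstep eqxx ltrDr (lt_trans _ lam1).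
      apply: (reach_closed Tcl _ wT) => [x' x'v _|]; first by rewrite finset.in_set.
      by have := fintype.subsetP TS _ wT; rewrite finset.in_set.
    - by move=> w /(extend0_out x) ->; rewrite normr0.
    - move=> w wS; rewrite -[in leRHS](enum_rankK_in wS wS).
      have := congr1 (fun M : 'cV_#|S| => M (enum_rank_in wS w) 0) Ax.
      rewrite adj_mulE mxE -(extend0_rank _ wS) => Aw.
      rewrite -{1}(ger0_norm (ltW (lt_trans ltr01 lam1))) -normrM Aw.
      exact: ler_norm_sum.
  by apply/matrixP => i j; rewrite ord1 mxE -extend0_val; apply/normr0_eq0.
pose g := extend0 (invmx (lam%:M - adj R S S) *m restrict S (fun w => 2 * z w)).
have gstep w : w \in S -> lam * g w - push g w = 2 * z w.
  move=> wS; rewrite /g; set y := invmx _ *m _.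
  have Ay : (lam%:M - adj R S S) *m y = restrict S (fun w => 2 * z w) by rewrite mulKVmx.
  have /= := congr1 (fun M : 'cV_#|S| => M (enum_rank_in wS w) 0) Ay.
  have Ey : ((lam%:M - adj R S S) *m y) (enum_rank_in wS w) 0 =
      lam * y (enum_rank_in wS w) 0 - (adj R S S *m y) (enum_rank_in wS w) 0.
    by rewrite mulmxBl mul_scalar_mx !mxE.
  by rewrite Ey adj_mulE -(extend0_rank y wS) mxE enum_rankK_in.
(* With [eps = 1 / K] one has [eps |g| <= z] on [S] and [eps <= 1 < lam]. *)
pose K := 1 + \sum_(w in S) `|g w| / z w.
have K1 : 1 <= K.
  by rewrite lerDl; apply: sumr_ge0 => w _; rewrite divr_ge0.
have K0 : 0 < K by exact: lt_le_trans K1.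
have gK w : w \in S -> K^-1 * `|g w| <= z w.
  move=> wS; rewrite mulrC ler_pdivrMr// -ler_pdivrMl ?zS// mulrC.
  rewrite /K (bigD1 w)//= addrCA lerDl addr_ge0//.
  by apply: sumr_ge0 => u _; rewrite divr_ge0.
pose eps := K^-1; have eps0 : 0 < eps by rewrite invr_gt0.
have eps1 : eps < lam by apply: le_lt_trans lam1; rewrite invf_le1.
pose lam' := lam - eps; have lam'0 : 0 < lam' by rewrite subr_gt0.
have h0 w : 0 <= z w + eps * g w.
  have [wS|wS] := boolP (w \in S); last by rewrite zout// /g extend0_out// mulr0 addr0.
  have := gK w wS; have : - (eps * g w) <= eps * `|g w|.
    by rewrite -mulrN ler_pM2l// -normrN ler_norm.
  rewrite -/eps; lra.
have fin w : (Zwv w v (ln lam') <= (z w + eps * g w)%:E)%E.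
  apply: (@Zwv_le_super R E (ln lam') v (fun u => z u + eps * g u)) => // u uv; rewrite lnK ?posrE// pushD pushZ.
  have uS : u \in S by rewrite finset.in_set.
  have -> : push g u = lam * g u - 2 * z u by rewrite -gstep//; ring.
  have -> : push z u = lam * z u - (if u == v then lam else 0) by rewrite zstep; ring.
  have : eps * (eps * g u) <= eps * z u.
    rewrite ler_pM2l//; apply: le_trans (gK u uS); rewrite ler_pM2l//; exact: ler_norm.
  rewrite /lam'; case: ifP => _; nra.
have : (Zv v (ln lam') < +oo)%E.
  rewrite Zv_sum; apply: lte_sum_pinfty => w _; apply: (le_lt_trans (fin w)).
  exact: ltry.
move=> /beta_v_le; rewrite leNgt => /negP; apply.
by rewrite -ltr_expR lnK ?posrE// /lam' -/lam ltrBlDr ltrDl.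
Qed.

Lemma Zv_dvg : (fine (Zv v beta))^-1 @[beta --> bv^'+] --> 0.
Proof.
apply/gtr0_cvgV0.
  near=> b; have vb : bv < b by near: b; exact: nbhs_right_gt.
  apply: fine_gt0; rewrite Zv_fin// andbT.
  by apply: lt_le_trans (Zwv_le _ v _); apply: Zwv_gt0; exact: reach_refl.
apply/cvgryPge => M.
have [b [vb Mb]] : exists b, bv < b /\ (M%:E < Zv v b)%E.
  apply: contrapT => nb; have := @Zv_at_beta_v M; rewrite Zv_beta_v_infty => H.
  have : (+oo <= M%:E :> \bar R)%E; last by rewrite leye_eq.
  apply: H => b vb; rewrite leNgt; apply/negP => lt; apply: nb.
  by exists b.
near=> c; have vc : bv < c by near: c; exact: nbhs_right_gt.
have cb : c <= b by near: c; exact: nbhs_right_le.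
rewrite -lee_fin fineK ?ge0_fin_numE ?pathsum_ge0 ?Zv_fin//.
exact: le_trans (ltW Mb) (pathsum_anti (Ev v) cb).
Unshelve. all: by end_near. Qed.

End Divergence.

(** * Limits of normalized generating functions *)

Lemma cvg_bigsum (R : realType) (T I : Type) (F : set_system T) {FF : Filter F}
    (s : seq I) (P : pred I) (f : I -> T -> R) (l : I -> R) :
  (forall i, P i -> f i x @[x --> F] --> l i) ->
  (\sum_(i <- s | P i) f i x) @[x --> F] --> \sum_(i <- s | P i) l i.
Proof.
move=> H; elim: s => [|i s IH].
  by under eq_fun do rewrite big_nil; rewrite big_nil; exact: cvg_cst.
under eq_fun do rewrite big_cons; rewrite big_cons; case: ifP => // Pi.
by apply: cvgD => //; exact: H.
Qed.

Lemma cvg_mulmx (R : realType) (T : Type) (F : set_system T) {FF : Filter F} m n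
    (M : 'M[R]_(m, n)) (x : T -> 'cV_n) (l : 'cV_n) :
  (forall j, x t j 0 @[t --> F] --> l j 0) ->
  forall i, (M *m x t) i 0 @[t --> F] --> (M *m l) i 0.
Proof.
move=> H i; rewrite mxE; under eq_fun do rewrite mxE.
by apply: cvg_bigsum => j _; apply: cvgMl_tmp; exact: H.
Qed.

Lemma cvgr_unique (R : realType) (T : Type) (F : set_system T) {FF : ProperFilter F}
    (f : T -> R) (a b : R) :
  f x @[x --> F] --> a -> f x @[x --> F] --> b -> a = b.
Proof. by move=> fa fb; apply: cvg_unique fa fb; exact: Rhausdorff. Qed.

Section Limits.
Variables (R : realType) (E : digraph) (v : vert E).
Notation V := (vert E).
Hypothesis hv : 0 < beta_v R v.
Let bv := beta_v R v.
Let lam := expR bv.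
Variable chi : V -> R.
Hypothesis chi_lim : forall w,
  (fine (Zwv w v beta) / fine (Zv v beta)) @[beta --> bv^'+] --> chi w.

Lemma expR_right : expR beta @[beta --> bv^'+] --> lam.
Proof. apply: cvg_at_right_filter; exact: continuous_expR. Qed.

Lemma fine_Zv_gt0 (beta : R) : bv < beta -> 0 < fine (Zv v beta).
Proof.
move=> vb; apply: fine_gt0; rewrite Zv_fin// andbT.
by apply: lt_le_trans (Zwv_le _ v _); apply: Zwv_gt0; exact: reach_refl.
Qed.

Lemma limit_ge0 w : 0 <= chi w.
Proof.
apply: (cvgr_to_ge (@chi_lim w)); near=> b.
by rewrite divr_ge0// fine_ge0// pathsum_ge0.
Unshelve. all: by end_near. Qed.

Lemma limit_supp w : chi w != 0 -> reach w v.
Proof.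
apply: contraR => wv; apply/eqP; apply: cvgr_unique (@chi_lim w) _.
rewrite (_ : (fun b => _) = cst 0); first exact: cvg_cst.
by apply/funext => b; rewrite Zwv_unreach// mul0r.
Qed.

Lemma limit_sum1 : \sum_w chi w = 1.
Proof.
apply: (@cvgr_unique R R bv^'+ _ (fun b => \sum_w (fine (Zwv w v b) / fine (Zv v b)))).
  apply: (cvg_bigsum (f := fun w b => fine (Zwv w v b) / fine (Zv v b))) => w _.
  exact: chi_lim.
apply: cvg_near_cst; near=> b; have vb : bv < b by near: b; exact: nbhs_right_gt.
have Zfin := Zv_fin hv vb.
have e : Zv v b = (\sum_w fine (Zwv w v b))%:E.
  by rewrite Zv_sum -sumEFin; apply: eq_bigr => w _; rewrite fineK// Zwv_fin_num.
by have := fine_Zv_gt0 vb; rewrite -mulr_suml e /= => Z0; rewrite divff// gt_eqF.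
Unshelve. all: by end_near. Qed.

(** Division of the recursion for [Z_{w,v}] by [Z_v] leaves the inhomogeneous
    term [e^beta / Z_v], which tends to 0. *)
Lemma limit_harmonic w : push chi w = lam * chi w.
Proof.
pose y w (beta : R) := fine (Zwv w v beta) / fine (Zv v beta).
apply/esym; apply: (@cvgr_unique R R bv^'+ _ (fun b => expR b * y w b)).
  by apply: cvgM (@chi_lim w); exact: expR_right.
pose f (beta : R) := (if w == v then expR beta else 0) * (fine (Zv v beta))^-1 + push (y^~ beta) w.
apply: (@cvg_trans _ (f @ bv^'+)).
  apply: near_eq_cvg; near=> b; have vb : bv < b by near: b; exact: nbhs_right_gt.
  rewrite /f /y mulrA fine_Zwv_step ?Zv_fin// mulrDl; congr (_ + _).
  by rewrite /push mulr_suml.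
have push_lim : push (y^~ beta) w @[beta --> bv^'+] --> push chi w.
  apply: (@cvg_bigsum R R _ bv^'+ _ _ _ (fun e b => y (rng e) b)) => e _; exact: chi_lim.
rewrite -[push chi w]add0r; apply: cvgD _ push_lim.
rewrite -[X in _ --> X](mulr0 (if w == v then lam else 0)).
apply: cvgM; last exact: Zv_dvg.
by case: eqP => _; [exact: expR_right|exact: cvg_cst].
Unshelve. all: by end_near. Qed.

(** On [C] the paths through [C] are all paths. On [D] the vector
    [y = Z^C / Z_v] satisfies [(lam - A_D) y_D = A_{D,C} y_C + (lam - e^beta) y_D],
    where the last term tends to 0 because [y] is bounded by 1. *)
Lemma ZC_limit C w : C \in pi_v_mc R v -> w \in upset C ->
  (fine (ZC C w v beta) / fine (Zv v beta)) @[beta --> bv^'+] -->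
    upset_extension bv (restrict C chi) w.
Proof.
move=> Cp wU; have /pi_v_mcP[Cc _ _ _ _] := Cp; have Cm := pi_v_mc_min Cp.
pose y (beta : R) u := fine (ZC C u v beta) / fine (Zv v beta).
have yC u : u \in C -> y beta u @[beta --> bv^'+] --> chi u.
  by move=> uC; rewrite /y; under eq_fun do rewrite ZC_mem//; exact: chi_lim.
have [wC|wC] := boolP (w \in C).
  by rewrite upset_extension_C// extend0_restrict /cutoff wC; exact: yC.
pose D := upset C :\: C; have wD : w \in D by rewrite finset.in_setD wC.
have uni : lam%:M - adj R D D \in unitmx by exact: upsetD_unit.
pose x (beta : R) : 'cV[R]_#|D| := adj R D C *m restrict C (y beta) + (lam - expR beta) *: restrict D (y beta).
have y01 beta u : bv < beta -> `|y beta u| <= 1.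
  move=> vb; have Z0 := fine_Zv_gt0 vb; have Zfin := Zv_fin hv vb.
  rewrite ger0_norm; last by rewrite divr_ge0// fine_ge0// pathsum_ge0.
  rewrite ler_pdivrMr// mul1r -lee_fin.
  have le : (ZC C u v beta <= Zv v beta)%E by exact: le_trans (ZC_le _ _ _ _) (Zwv_le _ _ _).
  rewrite !fineK// ge0_fin_numE ?pathsum_ge0//; exact: le_lt_trans Zfin.
have ystep beta u : bv < beta -> u \notin C -> push (y beta) u = expR beta * y beta u.
  move=> vb uC; have Zfin := Zv_fin hv vb.
  have fin u' : ZC C u' v beta \is a fin_num.
    rewrite ge0_fin_numE ?pathsum_ge0//; apply: le_lt_trans Zfin.
    exact: le_trans (ZC_le _ _ _ _) (Zwv_le _ _ _).
  rewrite /y mulrA /push -mulr_suml; congr (_ / _).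
  apply/eqP; rewrite -eqe EFinM fineK// ZC_step// -sumEFin; apply/eqP.
  by apply: eq_bigr => e _; rewrite fineK.
have ysplit beta u : y beta u = cutoff D (y beta) u + cutoff C (y beta) u.
  rewrite /cutoff finset.in_setD; case: ifP => [/andP[/negPf -> _]|]; first by rewrite addr0.
  case: (boolP (u \in C)) => [_ _|uC /=]; first by rewrite add0r.
  by move=> /negbT uU; rewrite /y ZC_out// mul0r addr0.
have yE beta : bv < beta -> restrict D (y beta) = invmx (lam%:M - adj R D D) *m x beta.
  move=> vb; apply: (canRL (mulKmx uni)); apply/matrixP => i j; rewrite ord1.
  have -> : ((lam%:M - adj R D D) *m restrict D (y beta)) i 0 =
      lam * y beta (enum_val i) - (adj R D D *m restrict D (y beta)) i 0.
    by rewrite mulmxBl mul_scalar_mx !mxE.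
  have -> : x beta i 0 = (adj R D C *m restrict C (y beta)) i 0 +
      (lam - expR beta) * y beta (enum_val i).
    by rewrite /x !mxE.
  have iD : enum_val i \notin C by have := enum_valP i; rewrite finset.in_setD => /andP[].
  have := ystep beta _ vb iD; rewrite (eq_push _ (ysplit beta)) pushD.
  rewrite !adj_mulE !(eq_push _ (extend0_restrict _ _)) mulrBl => <-; ring.
have xlim j : x beta j 0 @[beta --> bv^'+] --> (adj R D C *m restrict C chi) j 0.
  have -> : (fun beta => x beta j 0) = (fun beta =>
      (adj R D C *m restrict C (y beta)) j 0 + (lam - expR beta) * y beta (enum_val j)).
    by apply/funext => beta; rewrite /x !mxE.
  have c1 : (adj R D C *m restrict C (y beta)) j 0 @[beta --> bv^'+] -->
      (adj R D C *m restrict C chi) j 0.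
    apply: cvg_mulmx => i; rewrite mxE; under eq_fun do rewrite mxE.
    by apply: yC; exact: enum_valP.
  have c2 : (lam - expR beta) * y beta (enum_val j) @[beta --> bv^'+] --> 0.
    apply/norm_cvg0P; apply: (@squeeze_cvgr _ _ _ _ (cst 0) (fun b => `|lam - expR b|)).
    - near=> b; have vb : bv < b by near: b; exact: nbhs_right_gt.
      by rewrite normr_ge0 normrM ler_piMr// y01.
    - exact: cvg_cst.
    - apply/norm_cvg0P; rewrite -(subrr lam); apply: cvgB; [exact: cvg_cst|exact: expR_right].
  by rewrite -(addr0 ((adj R D C *m restrict C chi) j 0)); exact: cvgD c1 c2.
rewrite /upset_extension extend0_out// add0r (extend0_rank _ wD) -mulmxA.
apply: (@cvg_trans _ ((invmx (lam%:M - adj R D D) *m x beta) (enum_rank_in wD w) 0 @[beta --> bv^'+])).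
  apply: near_eq_cvg; near=> b; have vb : bv < b by near: b; exact: nbhs_right_gt.
  by rewrite -yE// mxE enum_rankK_in.
exact: cvg_mulmx.
Unshelve. all: by end_near. Qed.

End Limits.

(** * The complex exponential *)

Section ComplexExp.
Variable R : realType.
Local Notation C := R[i].

(** The derivative in the form of an explicit first-order estimate, from which
    the complex estimate is put together. *)
Lemma derive_bound (f : R -> R) (df : R) : is_derive (0 : R) (1 : R) f df ->
  forall eps, 0 < eps -> exists2 delta, 0 < delta &
    forall t, `|t| < delta -> `|f t - f 0 - df * t| <= eps * `|t|.
Proof.
move=> [fd fv] eps eps0.
have : (fun h => h^-1 *: ((f \o shift 0) (h *: (1 : R)) - f 0)) @ 0^' --> df.
  by rewrite -fv; exact: fd.
move=> /cvgrPdist_le /(_ eps eps0); rewrite near_withinE => /nbhs_ballP[d /= d0 H].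
exists d => // t td; have [->|t0] := eqVneq t 0.
  by rewrite mulr0 subr0 subrr normr0 mulr0.
have := H t; rewrite /ball/= sub0r normrN => /(_ td t0).
rewrite addr0 [t *: 1]mulr1 /GRing.scale/= => le.
have -> : f t - f 0 - df * t = - (df - t^-1 * (f t - f 0)) * t by field.
by rewrite normrM normrN ler_wpM2r.
Qed.

Definition cexp (z : C) : C :=
  (expR (complex.Re z))%:C%C * (cos (complex.Im z) +i* sin (complex.Im z))%C.

Lemma cexpD z w : cexp (z + w) = cexp z * cexp w.
Proof.
case: z w => [a b] [c d]; rewrite /cexp /= expRD cosD sinD; simpc.
by congr (_ +i* _)%C; ring.
Qed.

Lemma cexp_real (t : R) : cexp t%:C%C = (expR t)%:C%C.
Proof. by rewrite /cexp /= cos0 sin0; simpc. Qed.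

Lemma cexp_imag (t : R) : cexp ('i%C * t%:C%C) = (cos t +i* sin t)%C.
Proof. by rewrite /cexp /=; simpc; rewrite expR0; simpc. Qed.

Lemma Re_normD (z w : C) : complex.Re `|z + w| <= complex.Re `|z| + complex.Re `|w|.
Proof.
have := ler_normD z w; rewrite lecE => /andP[_].
by rewrite -(Re_normc z) -(Re_normc w) -rmorphD.
Qed.

Lemma Re_normM (z w : C) : complex.Re `|z * w| = complex.Re `|z| * complex.Re `|w|.
Proof. by rewrite normrM -(Re_normc z) -(Re_normc w) -rmorphM. Qed.

Lemma Re_norm_real (t : R) : complex.Re `|t%:C%C| = `|t|.
Proof. by rewrite normc_def /= expr0n addr0 sqrtr_sqr. Qed.

Lemma Re_norm_i : complex.Re `|'i%C : C| = 1.
Proof. by rewrite normc_def /= expr0n add0r expr1n sqrtr1. Qed.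

Lemma norm_Re_le (z : C) : `|complex.Re z| <= complex.Re `|z|.
Proof. by have := normc_ge_Re z; rewrite lecE => /andP[]. Qed.

Lemma norm_Im_le (z : C) : `|complex.Im z| <= complex.Re `|z|.
Proof.
by rewrite normc_def /= -sqrtr_sqr ler_wsqrtr// lerDr sqr_ge0.
Qed.

(** Complex differentiability of the exponential at 0: with [h = x + i y],
    [exp h - 1 - h] is the sum of [e^x - 1 - x],
    [(e^x - 1) (cos y - 1 + i sin y)] and [cos y - 1 + i (sin y - y)]. *)
Lemma cexp_bound (eps : R) : 0 < eps -> exists2 delta, 0 < delta &
  forall h : C, complex.Re `|h| < delta ->
    complex.Re `|cexp h - 1 - h| <= eps * complex.Re `|h|.
Proof.
(* The three terms are bounded by [e r], [6 e r] and [2 e r], where [r = |h|]. *)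
move=> eps0; have [e [e0 e1 e9]] : exists e : R, [/\ 0 < e, e <= 1 & 9 * e <= eps].
  exists (Num.min 1 (eps / 9)); split.
  - by rewrite lt_min ltr01 divr_gt0.
  - by rewrite ge_min lexx.
  - by rewrite -ler_pdivlMl// mulrC ge_min lexx orbT.
have [d1 d10 H1] := derive_bound (is_derive_expR 0) e0.
have [d2 d20 H2] := derive_bound (is_derive_cos 0) e0.
have [d3 d30 H3] := derive_bound (is_derive_sin 0) e0.
exists (Num.min e (Num.min d1 (Num.min d2 d3))); first by rewrite !lt_min e0 d10 d20 d30.
move=> h; rewrite !lt_min => /and4P[he hd1 hd2 hd3].
set x := complex.Re h; set y := complex.Im h; set r := complex.Re `|h| in he hd1 hd2 hd3 *.
have xr : `|x| <= r by exact: norm_Re_le.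
have yr : `|y| <= r by exact: norm_Im_le.
have := H1 x (le_lt_trans xr hd1); have := H2 y (le_lt_trans yr hd2).
have := H3 y (le_lt_trans yr hd3).
rewrite expR0 cos0 sin0 !oppr0 addr0 mul0r subr0 !mul1r => B3 B2 B1.
have -> : cexp h - 1 - h = (expR x - 1 - x)%:C%C
    + ((expR x - 1)%:C%C * ((cos y - 1)%:C%C + 'i%C * (sin y)%:C%C)
    + ((cos y - 1)%:C%C + 'i%C * (sin y - y)%:C%C)).
  rewrite [in LHS](complexE h) -/x -/y /cexp -/x -/y; simpc.
  by congr (_ +i* _)%C; ring.
have r0 : 0 <= r by exact: Re_norm_ge0.
have A1 : `|expR x - 1 - x| <= e * r by exact: le_trans B1 (ler_wpM2l (ltW e0) xr).
have A2 : `|cos y - 1| <= e * r by exact: le_trans B2 (ler_wpM2l (ltW e0) yr).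
have A3 : `|sin y - y| <= e * r by exact: le_trans B3 (ler_wpM2l (ltW e0) yr).
have A4 : `|sin y| <= e * r + r.
  by rewrite -[sin y](subrK y); apply: le_trans (ler_normD _ _) _; exact: lerD.
have A5 : `|expR x - 1| <= e * r + r.
  by rewrite -[expR x - 1](subrK x); apply: le_trans (ler_normD _ _) _; exact: lerD.
apply: le_trans (Re_normD _ _) _; rewrite Re_norm_real.
have N1 : complex.Re `|(cos y - 1)%:C%C + 'i%C * (sin y)%:C%C| <= e * r + (e * r + r).
  apply: le_trans (Re_normD _ _) _; rewrite Re_normM !Re_norm_real Re_norm_i mul1r.
  exact: lerD.
have N2 : complex.Re `|(cos y - 1)%:C%C + 'i%C * (sin y - y)%:C%C| <= e * r + e * r.
  apply: le_trans (Re_normD _ _) _; rewrite Re_normM !Re_norm_real Re_norm_i mul1r.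
  exact: lerD.
have N3 : complex.Re `|(expR x - 1)%:C%C * ((cos y - 1)%:C%C + 'i%C * (sin y)%:C%C)|
    <= (e * r + r) * (e * r + (e * r + r)).
  by rewrite Re_normM Re_norm_real; apply: ler_pM => //; exact: Re_norm_ge0.
have := Re_normD ((expR x - 1)%:C%C * ((cos y - 1)%:C%C + 'i%C * (sin y)%:C%C))
  ((cos y - 1)%:C%C + 'i%C * (sin y - y)%:C%C).
have : (e * r + r) * (e * r + (e * r + r)) <= 6 * e * r.
  have : e * r <= r by rewrite ler_piMl.
  have : r * r <= e * r by rewrite ler_wpM2r// ltW.
  nra.
move=> P1 P2; apply: le_trans (_ : 9 * e * r <= _); last by rewrite ler_wpM2r.
lra.
Qed.

End ComplexExp.

Section ComplexDerivative.
Variable R : realType.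
Local Notation C := R[i].

Lemma complex_gt0 (e : C) : 0 < e -> e = (complex.Re e)%:C%C /\ 0 < complex.Re e.
Proof. by case: e => a b; rewrite ltcE /= => /andP[/eqP -> ->]. Qed.

Lemma cexp_quotient (k : C) :
  (fun h : C^o => h^-1 * (cexp (k * h) - 1) : C^o) @ (0 : C^o)^' --> (k : C^o).
Proof.
apply/cvgrPdist_le => e /complex_gt0[-> e0]; set eps := complex.Re e in e0 *.
pose K := complex.Re `|k| + 1.
have K0 : 0 < K by rewrite ltr_wpDl// Re_norm_ge0.
have [d d0 H] := cexp_bound (divr_gt0 e0 K0).
rewrite near_withinE; apply/nbhs_ballP; exists (d / K)%:C%C => /=.
  by rewrite ltcR divr_gt0.
move=> h; rewrite /ball/= sub0r normrN -Re_normc ltcR ltr_pdivlMr// => hd h0.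
have kh : complex.Re `|k * h| < d.
  apply: le_lt_trans hd; rewrite Re_normM mulrC; apply: ler_wpM2l.
    exact: Re_norm_ge0.
  by rewrite lerDl.
have := H _ kh => le.
have -> : k - h^-1 * (cexp (k * h) - 1) = - (h^-1 * (cexp (k * h) - 1 - k * h)).
  by field.
rewrite normrN -Re_normc lecR Re_normM.
have h1 : complex.Re `|h^-1| * complex.Re `|h| = 1 by rewrite -Re_normM mulVf// normr1.
apply: le_trans (ler_wpM2l (Re_norm_ge0 _) le) _; rewrite Re_normM.
have -> : complex.Re `|h^-1| * (eps / K * (complex.Re `|k| * complex.Re `|h|)) =
   eps / K * complex.Re `|k| * (complex.Re `|h^-1| * complex.Re `|h|) by ring.
rewrite h1 mulr1 mulrAC ler_pdivrMr//.
by apply: ler_wpM2l; [exact: ltW|rewrite /K lerDl].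
Qed.

(** The functional equation reduces the derivative at [z] to the one at 0. *)
Lemma derivable_cexp (W : normedModType C) (k : C) (a : W) (z : C^o) :
  derivable (fun z : C^o => cexp (k * z) *: a : W) z 1.
Proof.
apply/cvg_ex; exists ((k * cexp (k * z)) *: a).
have -> : (fun h : C^o => h^-1 *: (((fun z : C^o => cexp (k * z) *: a : W) \o shift z) (h *: (1 : C^o))
    - cexp (k * z) *: a)) =
  (fun h : C^o => (h^-1 * (cexp (k * h) - 1) * cexp (k * z)) *: a).
  apply/funext => h /=; rewrite -scalerBl scalerA; congr (_ *: _).
  have -> : k * (h *: (1 : C) + z) = k * h + k * z by rewrite [h *: 1]mulr1 mulrDr.
  by rewrite cexpD -mulrA mulrBl mul1r.
apply: cvgZr_tmp; apply: (@cvgMr_tmp C _ (0 : C^o)^'); exact: cexp_quotient.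
Qed.

End ComplexDerivative.

Local Open Scope cstar_scope.

(** * Positive functionals on a C*-algebra *)

Lemma lipschitz_cont (R : realType) (V W : normedModType R[i]) (f : V -> W) (K : R[i]) :
  0 <= K -> (forall x y, `|f x - f y| <= K * `|x - y|) -> continuous f.
Proof.
move=> K0 H x; have K1 : 0 < K + 1 by rewrite ltr_wpDl.
apply/cvgrPdist_le => e e0; apply/nbhs_ballP; exists (e / (K + 1)) => /=.
  by rewrite divr_gt0.
move=> y; rewrite -ball_normE /= => /ltW; rewrite ler_pdivlMr// => le.
apply: le_trans (H x y) _; apply: le_trans le; rewrite mulrC.
by apply: ler_wpM2l; rewrite ?normr_ge0// lerDl.
Qed.

Section CstarAlgebra.
Variables (R : realType) (A : cstar_algebra R).
Local Notation C := R[i].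
Implicit Types (a b c x y : A) (th : functional A).

Lemma cmul0l b : 0 ** b = 0 :> A.
Proof. by apply: (addIr (0 ** b)); rewrite -cmulDl !add0r. Qed.

Lemma cmul0r a : a ** 0 = 0 :> A.
Proof. by apply: (addIr (a ** 0)); rewrite -cmulDr !add0r. Qed.

Lemma cmulNl a b : (- a) ** b = - (a ** b).
Proof. by apply: (addIr (a ** b)); rewrite -cmulDl !addNr cmul0l. Qed.

Lemma cmulNr a b : a ** (- b) = - (a ** b).
Proof. by apply: (addIr (a ** b)); rewrite -cmulDr !addNr cmul0r. Qed.

Lemma cmulBl a b c : (a - b) ** c = a ** c - b ** c.
Proof. by rewrite cmulDl cmulNl. Qed.

Lemma cmulBr a b c : a ** (b - c) = a ** b - a ** c.
Proof. by rewrite cmulDr cmulNr. Qed.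

Lemma star0 : (0 : A)^** = 0.
Proof. by apply: (addIr ((0 : A)^**)); rewrite -starD !add0r. Qed.

Lemma starN a : (- a)^** = - a^**.
Proof. by apply: (addIr (a^**)); rewrite -starD !addNr star0. Qed.

Lemma starB a b : (a - b)^** = a^** - b^**.
Proof. by rewrite starD starN. Qed.

Lemma norm_star a : `|a^**| = `|a|.
Proof.
have le b : `|b| <= `|b^**|.
  have [->|b0] := eqVneq b 0; first by rewrite star0.
  have nb : 0 < `|b| by rewrite normr_gt0.
  by rewrite -(ler_pM2r nb) -expr2 -cnorm_star cnormM.
by apply/eqP; rewrite eq_le le andbT -{2}(starK a).
Qed.

Lemma cmul_contl a : continuous (fun b : A => a ** b).
Proof. by apply: (lipschitz_cont (normr_ge0 a)) => x y; rewrite -cmulBr cnormM. Qed.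

Lemma cmul_contr b : continuous (fun a : A => a ** b).
Proof.
by apply: (lipschitz_cont (normr_ge0 b)) => x y; rewrite -cmulBl mulrC cnormM.
Qed.

Lemma star_cont : continuous (@star R A).
Proof. by apply: (lipschitz_cont ler01) => x y; rewrite -starB norm_star mul1r. Qed.

Lemma norm_projection a : projection a -> `|a| <= 1.
Proof.
move=> [sa pa]; have := cnorm_star a; rewrite sa pa => na.
have [->|a0] := eqVneq a 0; first by rewrite normr0 ler01.
have n0 : `|a| != 0 by rewrite normr_eq0.
have := na; rewrite expr2 -{1}(mulr1 `|a|) => /(mulfI n0) <-; exact: lexx.
Qed.

Section Functional.
Variable th : functional A.
Hypothesis lin : scalar th.

Lemma functionalD a b : th (a + b) = th a + th b.
Proof. by have := lin 1 a b; rewrite scale1r mul1r. Qed.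

Lemma functional0 : th 0 = 0.
Proof. by apply: (addIr (th 0)); rewrite -functionalD !add0r. Qed.

Lemma functionalZ k a : th (k *: a) = k * th a.
Proof. by have := lin k a 0; rewrite functional0 !addr0. Qed.

Lemma functionalN a : th (- a) = - th a.
Proof. by rewrite -scaleN1r functionalZ mulN1r. Qed.

Lemma functionalB a b : th (a - b) = th a - th b.
Proof. by rewrite functionalD functionalN. Qed.

Lemma functional_sum (I : Type) (r : seq I) (P : pred I) (F : I -> A) :
  th (\sum_(i <- r | P i) F i) = \sum_(i <- r | P i) th (F i).
Proof. exact: (big_morph th functionalD functional0). Qed.

End Functional.

(** The imaginary part of a real multiple of [Q] must cancel that of [D], and a
    real affine function that is bounded below is constant. *)
Lemma affine_ge0 (D Q : C) : (forall t : R, 0 <= D + t%:C%C * Q) -> Q = 0.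
Proof.
case: D Q => [d d'] [q q'] H.
have Him t : d' + t * q' = 0.
  by have := ger0_Im (H t); rewrite /= mul0r addr0.
have Hre t : 0 <= d + t * q.
  by have := H t; rewrite lecE /= => /andP[_]; rewrite mul0r subr0.
have q'0 : q' = 0 by have := Him 1; have := Him 0; lra.
have q0 : q = 0.
  apply/eqP/negPn/negP => q0; have := Hre (- (d + 1) / q).
  by rewrite divfK// opprD addrA subrr add0r; rewrite lerNr oppr0 leNgt ltr01.
by rewrite q'0 q0.
Qed.

(** An element [x] with [th (x^** ** x) = 0] lies in the kernel of the positive
    form, as in the Cauchy-Schwarz inequality: the values at [c + t x] are
    nonnegative for all complex [t], and affine in [t] along the real and the
    imaginary axis. *)
Lemma null_kernel th x : scalar th -> (forall a, 0 <= th (a^** ** a)) ->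
  th (x^** ** x) = 0 -> (forall b, th (b ** x) = 0) /\ (forall c, th (x^** ** c) = 0).
Proof.
move=> lin pos x0; have key c : th (c^** ** x) = 0 /\ th (x^** ** c) = 0.
  have E (t : C) : th (c^** ** c) + (t * th (c^** ** x) + (t^*)%C * th (x^** ** c)) =
      th ((c + t *: x)^** ** (c + t *: x)).
    rewrite starD starZ cmulDl !cmulDr !cmulZl !cmulZr !functionalD// !functionalZ// x0 !mulr0 addr0.
    by rewrite -addrA.
  have h1 : th (c^** ** x) + th (x^** ** c) = 0.
    apply: (@affine_ge0 (th (c^** ** c))) => t.
    by have := pos (c + t%:C%C *: x); rewrite -E conjc_real -mulrDr.
  have h2 : 'i%C * (th (c^** ** x) - th (x^** ** c)) = 0.
    apply: (@affine_ge0 (th (c^** ** c))) => t.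
    have := pos (c + (t%:C%C * 'i%C) *: x); rewrite -E.
    have -> : ((t%:C%C * 'i%C : C)^*)%C = - (t%:C%C * 'i%C).
      by apply/eqP; rewrite eq_complex /=; apply/andP; split; apply/eqP; ring.
    by rewrite mulNr -mulrBr mulrA.
  have i0 : ('i%C : C) != 0 by rewrite eq_complex /= oner_eq0 andbF.
  move/eqP: h2; rewrite mulf_eq0 (negPf i0) /= subr_eq0 => /eqP h2.
  move: h1; rewrite h2 -mulr2n => /eqP; rewrite mulrn_eq0 /= => /eqP h.
  by [].
split=> [b|c]; last by case: (key c).
by case: (key b^**); rewrite starK.
Qed.

End CstarAlgebra.

(** * Words in the generators of the Toeplitz algebra *)

Inductive letter (E : digraph) :=
  LVert of vert E | LEdge of edge E | LStar of edge E.

Section Letters.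
Variables (R : realType) (E : digraph) (A : cstar_algebra R).
Variables (p : vert E -> A) (s : edge E -> A).
Local Notation C := R[i].
Local Notation V := (vert E).
Local Notation L := (letter E).
Implicit Types (a b c x y : A) (g h k : L) (l : seq L) (th : functional A).

Definition lval g : A :=
  match g with LVert w => p w | LEdge e => s e | LStar e => (s e)^** end.

Definition ldeg g : R := match g with LVert _ => 0 | LEdge _ => 1 | LStar _ => -1 end.

Definition lstar g : L :=
  match g with LVert w => LVert w | LEdge e => LStar e | LStar e => LEdge e end.

Definition lmul l a : A := foldr (fun g b => lval g ** b) a l.
(** Products with a word on one side. There is no empty word, since the algebra
    is not assumed to be unital; with [lmul] and [rmul] a context around an
    element may still be empty on either side. *)
Definition rmul a l : A := foldl (fun b g => b ** lval g) a l.

Lemma lmulA l a b : lmul l (a ** b) = lmul l a ** b.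
Proof. by elim: l => //= g l ->; rewrite cmulA. Qed.

Lemma rmulA l a b : rmul (a ** b) l = a ** rmul b l.
Proof. by elim: l b => //= g l IH b; rewrite -cmulA IH. Qed.

Lemma lmul_cat l1 l2 a : lmul (l1 ++ l2) a = lmul l1 (lmul l2 a).
Proof. by rewrite /lmul foldr_cat. Qed.

Lemma rmul_cat l1 l2 a : rmul a (l1 ++ l2) = rmul (rmul a l1) l2.
Proof. by rewrite /rmul foldl_cat. Qed.

Lemma lmul_rmul l1 l2 a : lmul l1 (rmul a l2) = rmul (lmul l1 a) l2.
Proof. by elim: l1 => //= g l1 ->; rewrite rmulA. Qed.

Lemma lmulB l a b : lmul l (a - b) = lmul l a - lmul l b.
Proof. by elim: l => //= g l ->; rewrite cmulBr. Qed.

Lemma rmulB l a b : rmul (a - b) l = rmul a l - rmul b l.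
Proof. by elim: l a b => //= g l IH a b; rewrite cmulBl IH. Qed.

Lemma lmul_word l g :
  exists h l', lmul l (lval g) = rmul (lval h) l' /\ size l' = size l.
Proof.
elim: l => [|h l [h' [l' /= [-> <-]]]]; first by exists g, [::].
by exists h, (h' :: l'); rewrite /= rmulA.
Qed.

Lemma rmul_lmul a l b : rmul a l ** b = a ** lmul l b.
Proof. by elim: l a => //= g l IH a; rewrite IH cmulA. Qed.

Definition word a := exists g l, a = rmul (lval g) l.

Lemma word_mul a b : word a -> word b -> word (a ** b).
Proof.
move=> [g [l ->]] [h [l' ->]]; exists g, (l ++ h :: l').
by rewrite rmul_cat /= rmulA.
Qed.

Hypothesis fam : toeplitz_family p s.

Lemma star_p w : (p w)^** = p w.
Proof. by case: (tf_proj fam w). Qed.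

Lemma lval_star g : (lval g)^** = lval (lstar g).
Proof. by case: g => //= [w|e]; rewrite ?star_p ?starK. Qed.

Lemma star_rmul a l : (rmul a l)^** = lmul (rev (map lstar l)) a^**.
Proof.
elim: l a => //= g l IH a; rewrite IH starM rev_cons -cats1 lmul_cat /=.
by rewrite lval_star.
Qed.

Lemma word_star a : word a -> word a^**.
Proof.
move=> [g [l ->]]; rewrite star_rmul lval_star.
by have [h [l' [-> _]]] := lmul_word (rev (map lstar l)) (lstar g); exists h, l'.
Qed.

Lemma p_idem w : p w ** p w = p w.
Proof. by case: (tf_proj fam w). Qed.

Lemma s_range e : s e ** p (rng e) = s e.
Proof. by rewrite -(tf_source fam) cmulA; exact: (tf_isom fam e). Qed.

Lemma range_star e : p (rng e) ** (s e)^** = (s e)^**.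
Proof. by rewrite -[in RHS](s_range e) starM star_p. Qed.

Lemma star_s_neq e f : e <> f -> (s e)^** ** s f = 0.
Proof.
move=> ef; have := congr1 (fun a => ((s e)^** ** a) ** s f) (tf_range fam ef).
rewrite cmul0r cmul0l => <-.
rewrite -[in LHS]range_star -[in LHS](s_range f) -!(tf_source fam) !cmulA.
by rewrite (tf_source fam).
Qed.

(** Vanishes when the range projection of [s e] lies below [p (src e)]. In a
    C*-algebra this follows from the inequality between the sum of the range
    projections and [p (src e)], but by spectral theory; it is enough that
    the defect is in the kernel of every KMS state. *)
Definition defect e : A := (s e)^** - (s e)^** ** p (src e).

Lemma range_defect e : p (rng e) ** defect e = defect e.
Proof. by rewrite cmulBr cmulA range_star. Qed.

Lemma defect_range e : (defect e)^** ** p (rng e) = (defect e)^**.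
Proof. by rewrite -[in RHS]range_defect starM star_p. Qed.

Lemma defect_star e : (defect e)^** = s e - p (src e) ** s e.
Proof. by rewrite starB starM starK star_p. Qed.

(** Formally [(1 - p w) a (1 - p w)], without the unit. *)
Definition corner w a := a - a ** p w - p w ** a + p w ** a ** p w.

Lemma corner_square w a :
  (a - a ** p w)^** ** (a - a ** p w) = corner w (a^** ** a).
Proof.
by rewrite starB starM star_p cmulBl !cmulBr /corner !cmulA opprD opprK addrA.
Qed.

Lemma cornerD w a b : corner w (a + b) = corner w a + corner w b.
Proof.
rewrite /corner !cmulDl !cmulDr !cmulDl !opprD.
by rewrite !addrA (ACl ((1*3*5*7)*(2*4*6*8)))/= !addrA.
Qed.

Lemma corner_p w : corner w (p w) = 0.
Proof. by rewrite /corner !p_idem subrr sub0r addNr. Qed.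

(** Compressing [p w - \sum s s^** = c^** ** c] to the corner of [1 - p w]
    gives [0 - \sum x^** ** x = y^** ** y], where the [x] are the defects of
    the edges out of [w]. A state is nonnegative on each of these squares, hence 0
    on all of them. *)
Lemma state_defect th e : state th -> th ((defect e)^** ** defect e) = 0.
Proof.
move=> [lin pos _ _]; have [c Hc] := tf_sum fam (src e).
pose w := src e.
have sumE : corner w (\sum_(f | src f == w) s f ** (s f)^**) =
    \sum_(f | src f == w) (defect f)^** ** defect f.
  rewrite (big_morph (corner w) (cornerD w) (_ : _ = 0)); last first.
    by rewrite /corner cmul0l cmul0r cmul0l !subr0 addr0.
  apply: eq_bigr => f /eqP fw; rewrite /defect -fw corner_square starK.
  by rewrite fw.
have tot : th ((c - c ** p w)^** ** (c - c ** p w)) +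
    \sum_(f | src f == w) th ((defect f)^** ** defect f) = 0.
  rewrite -(functional_sum lin) -(functionalD lin) corner_square -Hc -sumE -cornerD subrK corner_p.
  exact: functional0.
have s0 : 0 <= \sum_(f | src f == w) th ((defect f)^** ** defect f).
  by apply: sumr_ge0 => f _; exact: pos.
move/eqP: tot; rewrite (paddr_eq0 (pos _) s0).
move=> /andP[_]; rewrite psumr_eq0; last by move=> f _; exact: pos.
by move=> /allP/(_ e (mem_index_enum _)); rewrite eqxx => /eqP.
Qed.

(** The product of two letters, as a letter or as 0. Normal order means that the
    edges precede the adjoints of edges and that there are no vertices; only
    pairs that are not in normal order are reduced. *)
Definition reduct g h : option L :=
  match g, h with
  | LVert w, LVert u => if w == u then Some h else None
  | LVert w, LEdge e => if w == src e then Some h else None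
  | LVert w, LStar e => if w == rng e then Some h else None
  | LEdge e, LVert w => if w == rng e then Some g else None
  | LStar e, LVert w => if w == src e then Some g else None
  | LStar e, LEdge f => if e == f then Some (LVert (rng e)) else None
  | _, _ => None
  end.

Definition normal_pair g h : bool :=
  match g, h with
  | LEdge _, LEdge _ | LEdge _, LStar _ | LStar _, LStar _ => true
  | _, _ => false
  end.

Definition oval (o : option L) : A := oapp lval 0 o.

(** What a KMS state says about words. All conditions are linear in the
    functional, so that differences of KMS states are covered. *)
Record word_kms (beta : R) th : Prop := {
  wk_lin : scalar th;
  wk_cont : continuous (th : A -> C^o);
  wk_letter : forall g b,
    th (lval g ** b) = (expR (- beta * ldeg g))%:C%C * th (b ** lval g);
  wk_red : forall g h, ~~ normal_pair g h -> forall l1 l2,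
    th (lmul l1 (rmul (lval g ** lval h) l2)) = th (lmul l1 (rmul (oval (reduct g h)) l2))
}.

Section WordKMS.
Variables (beta : R) (th : functional A).
Hypothesis letters : forall g b,
    th (lval g ** b) = (expR (- beta * ldeg g))%:C%C * th (b ** lval g).

Definition deg l : R := \sum_(g <- l) ldeg g.

Lemma kms_commute_word l a : th (lmul l a) = (expR (- beta * deg l))%:C%C * th (rmul a l).
Proof.
elim: l a => [|g l IH] a; first by rewrite /deg big_nil mulr0 expR0 mul1r.
rewrite /= letters -lmulA IH /deg big_cons mulrDr expRD rmorphM mulrA.
by [].
Qed.

End WordKMS.

Lemma lmul0 l : lmul l 0 = 0.
Proof. by elim: l => //= g l ->; rewrite cmul0r. Qed.

Lemma rmul0 l : rmul 0 l = 0.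
Proof. by elim: l => //= g l IH; rewrite cmul0l. Qed.

Definition is_edge g := if g is LEdge _ then true else false.
Definition is_star g := if g is LStar _ then true else false.

(** Going backwards from an edge, normal order only allows edges. *)
Lemma normal_edges g l h : is_edge h -> path normal_pair g (rcons l h) ->
  all is_edge (g :: l).
Proof.
move=> hE; elim: l g => [|k l IH] g /=; first by case: g; case: h hE.
by move=> /andP[gk /IH /= /andP[kE ->]]; case: g gk; case: k kE.
Qed.

Lemma normal_stars g l : is_star g -> path normal_pair g l -> all is_star (g :: l).
Proof.
elim: l g => [|k l IH] g gS /=; first by rewrite gS.
move=> /andP[gk /IH H]; rewrite gS; apply: H.
by case: g gS gk => // e _; case: k.
Qed.

(** A cyclic word in normal order consists of edges only or of adjoints of edges
    only. *)
Lemma normal_cycle_deg g l : path normal_pair g (rcons l g) -> deg (g :: l) != 0.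
Proof.
have edges m : all is_edge m -> deg m = (size m)%:R.
  elim: m => [|h m IH] /=; first by rewrite /deg big_nil.
  by move=> /andP[hE /IH kE]; rewrite /deg big_cons -/(deg m) kE -natr1 addrC; case: h hE.
have stars m : all is_star m -> deg m = - (size m)%:R.
  elim: m => [|h m IH] /=; first by rewrite /deg big_nil oppr0.
  by move=> /andP[hE /IH kE]; rewrite /deg big_cons -/(deg m) kE -natr1 opprD addrC; case: h hE.
case: g => [w|e|e] H.
- by case: l H.
- by rewrite edges ?pnatr_eq0//; exact: (normal_edges (h := LEdge e)) H.
- rewrite stars ?oppr_eq0 ?pnatr_eq0//.
  by have /= := normal_stars (g := LStar e) isT H; rewrite all_rcons.
Qed.

Lemma abnormal_pair g l : ~~ path normal_pair g l ->
  exists l1 (x y : L) l2, g :: l = l1 ++ x :: y :: l2 /\ ~~ normal_pair x y.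
Proof.
elim: l g => //= h l IH g; rewrite negb_and; case: (boolP (normal_pair g h)) => /= [_ /IH|H _].
  by move=> [l1 [x [y [l2 [-> H]]]]]; exists (g :: l1), x, y, l2.
by exists [::], g, h, l.
Qed.

(** If two cyclically adjacent letters are not in normal order, the word can be
    rotated and shortened. Otherwise its degree [d] is not 0, and moving the
    whole word around a vertex projection that fixes it multiplies the value by
    [expR (- beta * d)], so the value is 0. *)
Lemma word_kms_vanish beta th : 0 < beta -> word_kms beta th -> (forall w, th (p w) = 0) ->
  forall a, word a -> th a = 0.
Proof.
move=> beta0 [lin _ letters red] th0 _ [g [l ->]].
have [n] := ubnP (size l); elim: n g l => // n IH g l; rewrite ltnS => ln.
have short l1 o l2 : (size l1 + size l2 < size l)%N -> th (lmul l1 (rmul (oval o) l2)) = 0.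
  case: o => [k|] /= le; last by rewrite rmul0 lmul0 functional0.
  rewrite lmul_rmul; have [h [l' [-> sl']]] := lmul_word l1 k.
  by rewrite -rmul_cat; apply: IH; rewrite size_cat sl'; exact: leq_trans le ln.
(* The appended copy of [g] makes the last and the first letter adjacent. *)
case: (boolP (path normal_pair g (rcons l g))) => [/normal_cycle_deg d0|].
  have [w wg] : exists w, reduct (LVert w) g = Some g.
    by case: (g) => [w|e|e]; [exists w|exists (src e)|exists (rng e)]; rewrite /= eqxx.
  have pW : th (p w ** rmul (lval g) l) = th (rmul (lval g) l).
    by rewrite -rmulA; have := red (LVert w) g isT [::] l; rewrite wg.
  have := kms_commute_word letters (g :: l) (p w); rewrite /= rmulA pW -rmul_lmul.
  have := letters (LVert w) (rmul (lval g) l); rewrite /= mulr0 expR0 mul1r pW => <- /eqP.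
  rewrite -subr_eq0 -[X in X - _]mul1r -mulrBl mulf_eq0 => /orP[|/eqP//].
  rewrite subr_eq0 eq_sym => /eqP/complexI/eqP; rewrite -expR0 => /eqP/expR_inj/eqP.
  by rewrite mulf_eq0 oppr_eq0 gt_eqF// (negPf d0).
move=> /abnormal_pair[l1 [x [y [l2 [eL nxy]]]]].
(* If [l2] is empty, the pair consists of the last and the first letter. *)
case/lastP: l2 eL => [|l2 z].
  rewrite -rcons_cons -cat_rcons cats1 => /rcons_inj[eL gy].
  case: l1 eL => [[gx lE]|g' l1 [_ lE]].
    by move: nxy; rewrite lE -gy -gx; case: (g) => [w|//|//] _ /=.
  have -> : rmul (lval g) l = rmul (lval g) l1 ** lval x.
    by rewrite lE -cats1 rmul_cat.
  have := letters x (rmul (lval g) l1).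
  rewrite -rmulA; have := red x y nxy [::] l1; rewrite -gy /= => ->.
  rewrite (short [::]) ?lE ?size_rcons//= => /esym/eqP; rewrite mulf_eq0 => /orP[|/eqP//].
  by rewrite -[0]/(0%:C%C) (inj_eq (@complexI R)) gt_eqF// expR_gt0.
rewrite -rcons_cons -!rcons_cons -rcons_cat => /rcons_inj[eL _].
case: l1 eL => [[-> lE]|g' l1 [_ lE]].
  have := red x y nxy [::] l2; rewrite /= lE /= => ->; apply: (short [::]); by rewrite lE.
have -> : rmul (lval g) l = lmul (g :: l1) (rmul (lval x ** lval y) l2).
  by rewrite lE rmul_cat /= -rmul_lmul -rmulA cmulA.
by rewrite red//; apply: short; rewrite lE size_cat /= !addnS addSn.
Qed.

End Letters.

(** * KMS functionals are determined by the vertex projections *)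

Section Toeplitz.
Variables (R : realType) (E : digraph) (A : cstar_algebra R).
Variables (p : vert E -> A) (s : edge E -> A).
Local Notation C := R[i].
Local Notation V := (vert E).
Hypothesis hA : is_toeplitz_algebra p s.
Let fam : toeplitz_family p s := ta_family hA.

Definition closed_subspace (B : set A) : Prop :=
  [/\ closed B, B 0 & forall c a b, B a -> B b -> B (c *: a + b)].

Lemma closed_subspace_preimage (B : set A) (f : A -> A) : closed_subspace B ->
  continuous f -> linear f -> closed_subspace (f @^-1` B).
Proof.
move=> [Bc B0 Bl] fc fl; split.
- by apply: closed_comp => // x _; exact: fc.
- have f0 : f 0 = 0.
    by have := fl (-1) 0 0; rewrite scaler0 addr0 scaleN1r addNr.
  by rewrite /= f0.
- by move=> c a b /= Ba Bb; rewrite fl; exact: Bl.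
Qed.

(** The closed span of the words is a closed star-subalgebra that contains the
    generators. Its closure under products is proved one factor at a time:
    the elements whose product with a fixed element lies in the span form a
    closed subspace again. *)
Lemma closed_subspace_words (B : set A) : closed_subspace B ->
  (forall a, word p s a -> B a) -> forall a, B a.
Proof.
(* [K] is the closed span of the words. *)
pose K a := forall L : set A, closed_subspace L -> (forall a, word p s a -> L a) -> L a.
have Kw a : word p s a -> K a by move=> wa L _; exact.
have Ksub : closed_subspace K.
  split.
  - move=> a Ka L Ls Lw; have [Lc _ _] := Ls; apply: Lc => U Ua.
    by have [b [Kb Ub]] := Ka U Ua; exists b; split => //; exact: Kb.
  - by move=> L [].
  - by move=> c a b Ka Kb L Ls Lw; have [_ _ Ll] := Ls; apply: Ll; [exact: Ka|exact: Kb].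
have Kmulw a b : word p s a -> K b -> K (a ** b).
  move=> wa Kb; apply: (Kb [set b | K (a ** b)]).
    apply: closed_subspace_preimage => //; first exact: cmul_contl.
    by move=> c x y; rewrite cmulDr cmulZr.
  by move=> c wc; apply: Kw; exact: word_mul.
have Kmul a b : K a -> K b -> K (a ** b).
  move=> Ka Kb; apply: (Ka [set a | K (a ** b)]).
    apply: closed_subspace_preimage => //; first exact: cmul_contr.
    by move=> c x y; rewrite cmulDl cmulZl.
  by move=> c wc; exact: Kmulw.
have Kstar a : K a -> K a^**.
  move=> Ka; apply: (Ka [set a | K a^**]); last by move=> c wc; apply: Kw; exact: word_star.
  have [Kc K0 Kl] := Ksub; split.
  - by apply: closed_comp => // x _; exact: star_cont.
  - by rewrite /= star0.
  - by move=> c x y /= Kx Ky; rewrite starD starZ; exact: Kl.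
have Kall : forall a, K a.
  apply: (ta_generated hA).
  - by have [Kc K0 Kl] := Ksub; split.
  - by move=> w; apply: Kw; exists (LVert w), [::].
  - by move=> e; apply: Kw; exists (LEdge e), [::].
by move=> Bs Bw a; exact: Kall.
Qed.

Lemma word_kms_eq0 beta th : 0 < beta -> word_kms p s beta th ->
  (forall w, th (p w) = 0) -> forall a, th a = 0.
Proof.
move=> beta0 Hc th0; have [lin cont _ _] := Hc.
apply: (@closed_subspace_words [set a | th a = 0]); last by move=> a wa; exact: (word_kms_vanish beta0 Hc th0 wa).
split.
- have -> : [set a | th a = 0] = (th : A -> C^o) @^-1` [set (0 : C^o)] by [].
  apply: closed_comp; first by move=> x _; exact: cont.
  exact: (accessible_closed_set1 (hausdorff_accessible (@norm_hausdorff C C^o))). 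
- exact: functional0.
- by move=> c a b /= a0 b0; rewrite lin a0 b0 mulr0 addr0.
Qed.

Lemma word_kms0 beta : word_kms p s beta (fun=> 0).
Proof.
split => //.
- by move=> c a b; rewrite mulr0 addr0.
- by move=> a; exact: cvg_cst.
- by move=> g b; rewrite mulr0.
Qed.

Lemma word_kms_combine beta k th1 th2 : word_kms p s beta th1 -> word_kms p s beta th2 ->
  word_kms p s beta (fun a => k * th1 a + th2 a).
Proof.
move=> [l1 c1 k1 r1] [l2 c2 k2 r2]; split.
- by move=> c a b; rewrite l1 l2 !mulrDr; ring.
- by move=> a; apply: cvgD; [apply: (@cvgMl_tmp C); exact: c1|exact: c2].
- by move=> g b; rewrite k1 k2; ring.
- by move=> g h gh l l'; rewrite r1// r2.
Qed.

Lemma word_kms_sum beta (I : eqType) (r : seq I) (P : pred I) (k : I -> C) (th : I -> functional A) :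
  (forall i, P i -> word_kms p s beta (th i)) ->
  word_kms p s beta (fun a => \sum_(i <- r | P i) k i * th i a).
Proof.
move=> H; elim: r => [|i r IH].
  by under eq_fun do rewrite big_nil; exact: word_kms0.
case Pi: (P i); under eq_fun do rewrite big_cons Pi; last exact: IH.
by apply: word_kms_combine IH; exact: H.
Qed.

Variable alpha : R -> A -> A.
Hypothesis halpha : gauge_action p s alpha.

Lemma state_cont th : state th -> continuous (th : A -> C^o).
Proof.
move=> [lin _ bd _]; apply: (lipschitz_cont (K := 1)) => // x y.
by rewrite mul1r -(functionalB lin); exact: bd.
Qed.

(** Each letter is an eigenvector of the gauge action, with an exponential as
    eigenvalue. *)
Lemma letter_entire g :
  entire_extension alpha (lval p s g) (fun z => cexp ('i%C * (ldeg R g)%:C%C * z) *: lval p s g).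
Proof.
split=> [z|t]; first exact: derivable_cexp.
rewrite -mulrA -rmorphM cexp_imag; case: g => [w|e|e] /=.
- by rewrite mul0r cos0 sin0 scale1r (gauge_vert halpha).
- by rewrite mul1r (gauge_edge halpha).
- have [_ _ hs] := gauge_hom halpha t.
  by rewrite mulN1r cosN sinN hs (gauge_edge halpha) starZ.
Qed.

Lemma kms_letter beta th : kms_state alpha beta th -> forall g b,
  th (lval p s g ** b) = (expR (- beta * ldeg R g))%:C%C * th (b ** lval p s g).
Proof.
move=> [[lin _ _ _] kms] g b; rewrite (kms _ _ (letter_entire g)) cmulZr (functionalZ lin).
congr (_ * _); rewrite -cexp_real; congr cexp.
by apply/eqP; rewrite eq_complex /=; apply/andP; split; apply/eqP; ring.
Qed.

(** The defects are in the kernel of the form of the state. The KMS condition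
    moves everything that follows a defect to its left, so a word that
    contains a defect has value 0, and the reductions that hold up to defects
    hold for the state. *)
Lemma kms_word_kms beta th : kms_state alpha beta th -> word_kms p s beta th.
Proof.
move=> Hk; have letters := kms_letter Hk; have [Hst _] := Hk.
have [lin pos _ _] := Hst.
have nulls e := null_kernel lin pos (state_defect fam e Hst).
(* The factor [p (rng e)] keeps the left context from being empty. *)
have kill e l1 l2 : th (lmul p s l1 (rmul p s (defect p s e) l2)) = 0.
  have -> : rmul p s (defect p s e) l2 = rmul p s (p (rng e) ** defect p s e) l2.
    by rewrite range_defect.
  rewrite lmul_rmul.
  have := kms_commute_word letters l2 (lmul p s l1 (p (rng e) ** defect p s e)).
  rewrite !lmulA (nulls e).1 => /esym/eqP; rewrite mulf_eq0 => /orP[|/eqP//].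
  by rewrite -[0]/(0%:C%C) (inj_eq (@complexI R)) gt_eqF// expR_gt0.
have kill_star e l1 l2 : th (lmul p s l1 (rmul p s (defect p s e)^** l2)) = 0.
  rewrite (kms_commute_word letters) -rmul_cat -[X in rmul _ _ X](defect_range fam).
  by rewrite rmulA (nulls e).2 mulr0.
split => //; first exact: state_cont.
move=> g h gh l1 l2; apply/eqP; rewrite -subr_eq0 -(functionalB lin) -lmulB -rmulB; apply/eqP.
have zero : th (lmul p s l1 (rmul p s 0 l2)) = 0 by rewrite rmul0 lmul0 (functional0 lin).
have fmulC a b : a = 0 -> a = b -> b = 0 :> C by move=> -> <-.
case: g h gh => [w|e|e] [u|f|f] //= _.
- case: eqP => [->|wu] /=; first by rewrite (p_idem fam) subrr.
  by rewrite (tf_orth fam wu) subrr.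
- case: eqP => [->|wu] /=.
    by rewrite -opprB -(defect_star fam) -[- _]sub0r rmulB lmulB (functionalB lin) zero kill_star subrr.
  have -> : p w ** s f - 0 = p w ** (defect p s f)^**.
    by rewrite subr0 (defect_star fam) cmulBr cmulA (tf_orth fam wu) cmul0l subr0.
  by have := kill_star f (l1 ++ [:: LVert w]) l2; rewrite lmul_cat /= rmulA.
- case: eqP => [->|wu] /=; first by rewrite (range_star fam) subrr.
  by rewrite -(range_star fam) cmulA (tf_orth fam wu) cmul0l subrr.
- case: eqP => [->|wu] /=; first by rewrite (s_range fam) subrr.
  have uw : rng e <> u by move=> eu; apply: wu.
  by rewrite -(s_range fam) -cmulA (tf_orth fam uw) cmul0r subrr.
- case: eqP => [->|wu] /=.
    by rewrite -opprB -/(defect p s e) -[- _]sub0r rmulB lmulB (functionalB lin) zero kill subrr.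
  have uw : src e <> u by move=> eu; apply: wu.
  have -> : (s e)^** ** p u - 0 = defect p s e ** p u.
    by rewrite subr0 cmulBl -cmulA (tf_orth fam uw) cmul0r subr0.
  exact: (kill e l1 (LVert u :: l2)).
- case: eqP => [->|ef] /=; first by rewrite (tf_source fam) subrr.
  by rewrite (star_s_neq fam ef) subrr.
Qed.

End Toeplitz.

(** * Measures on the path space *)

Section Support.
Variables (R : realType) (E : digraph) (A : cstar_algebra R).
Variables (p : vert E -> A) (s : edge E -> A).

Definition supported_at (v0 : vert E) (th : functional A) : Prop :=
  exists m : {measure set (g_sigma_algebraType (@cylinders E v0)) -> \bar R},
    (forall mu : fpath E,
       m (cylinder mu) = (complex.Re (th (s_path p s mu ** (s_path p s mu)^**)))%:E) /\
    m (@finite_paths E) = 0%E.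

(** The base point enters the type but not the sets or the sigma-algebra; the
    image under the identity is a measure for the other base point. *)
Lemma supported_change_point v0 th :
  supported_on_infinite_paths p s th -> supported_at v0 th.
Proof.
move=> [u [m [mc m0]]].
pose T1 := g_sigma_algebraType (@cylinders E u).
pose T2 := g_sigma_algebraType (@cylinders E v0).
pose f : T1 -> T2 := fun x => x.
have mf : measurable_fun [set: T1] f by move=> _ Y mY; rewrite setTI; exact: mY.
by exists (pushforward m f).
Unshelve. exact: mf. Qed.

Lemma supported0 v0 : supported_at v0 (fun=> 0).
Proof. by exists mzero. Qed.

Lemma supportedD v0 (k : R) th1 th2 : 0 <= k ->
  supported_at v0 th1 -> supported_at v0 th2 ->
  supported_at v0 (fun a => k%:C%C * th1 a + th2 a).
Proof.
move=> k0 [m1 [c1 z1]] [m2 [c2 z2]].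
pose m : {measure set (g_sigma_algebraType (@cylinders E v0)) -> \bar R} :=
  measure_add (mscale (NngNum k0) m1) m2.
have mE X : m X = (k%:E * m1 X + m2 X)%E by exact: measure_addE.
exists m; split => [mu|]; last by rewrite mE z1 z2 mule0 adde0.
rewrite mE c1 c2 -EFinM -EFinD; congr (_%:E).
by rewrite raddfD /=; congr (_ + _); case: (th1 _) => a b /=; rewrite mul0r subr0.
Qed.

Lemma supported_sum v0 (I : eqType) (r : seq I) (P : pred I) (k : I -> R) (th : I -> functional A) :
  (forall i, P i -> 0 <= k i) -> (forall i, P i -> supported_at v0 (th i)) ->
  supported_at v0 (fun a => \sum_(i <- r | P i) (k i)%:C%C * th i a).
Proof.
move=> k0 H; elim: r => [|i r IH].
  by under eq_fun do rewrite big_nil; exact: supported0.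
case Pi: (P i); under eq_fun do rewrite big_cons Pi; last exact: IH.
by apply: supportedD IH; [exact: k0|exact: H].
Qed.

End Support.

(** * Limits of KMS states *)

Section KMSLimit.
Variables (R : realType) (A : cstar_algebra R).
Local Notation C := R[i].

Lemma Re_cvg (T : Type) (F : set_system T) {FF : Filter F} (f : T -> C) (l : C) :
  (f x : C^o) @[x --> F] --> (l : C^o) ->
  complex.Re (f x) @[x --> F] --> complex.Re l.
Proof.
move=> H; apply/cvgrPdist_lt => e e0.
have e0' : 0 < e%:C%C :> C by rewrite ltcR.
move/cvgrPdist_lt : H => /(_ _ e0'); apply: filterS => x.
rewrite -Re_normc ltcR => lt; apply: le_lt_trans lt.
by rewrite -[X in `|X|]/(complex.Re l - complex.Re (f x)) -raddfB; exact: norm_Re_le.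
Qed.

Lemma Im_cvg (T : Type) (F : set_system T) {FF : Filter F} (f : T -> C) (l : C) :
  (f x : C^o) @[x --> F] --> (l : C^o) ->
  complex.Im (f x) @[x --> F] --> complex.Im l.
Proof.
move=> H; apply/cvgrPdist_lt => e e0.
have e0' : 0 < e%:C%C :> C by rewrite ltcR.
move/cvgrPdist_lt : H => /(_ _ e0'); apply: filterS => x.
rewrite -Re_normc ltcR => lt; apply: le_lt_trans lt.
by rewrite -raddfB; exact: norm_Im_le.
Qed.

Lemma complex_cvg_ge0 (T : Type) (F : set_system T) {FF : ProperFilter F} (f : T -> C) (l : C) :
  (f x : C^o) @[x --> F] --> (l : C^o) -> (\forall x \near F, 0 <= f x) -> 0 <= l.
Proof.
move=> H f0; rewrite lecE; apply/andP; split.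
  apply/eqP; apply: (cvgr_unique (Im_cvg H)); apply: cvg_near_cst.
  by apply: filterS f0 => x /ger0_Im.
apply: (cvgr_to_ge (Re_cvg H)); apply: filterS f0 => x.
by rewrite lecE => /andP[].
Qed.

Lemma complex_cvg_unique (T : Type) (F : set_system T) {FF : ProperFilter F} (f : T -> C) (l l' : C) :
  (f x : C^o) @[x --> F] --> (l : C^o) -> (f x : C^o) @[x --> F] --> (l' : C^o) -> l = l'.
Proof.
move=> fl fl'; apply/eqP; rewrite eq_complex; apply/andP; split; apply/eqP.
  exact: cvgr_unique (Re_cvg fl) (Re_cvg fl').
exact: cvgr_unique (Im_cvg fl) (Im_cvg fl').
Qed.

Variables (alpha : R -> A -> A) (bv : R) (phi_ : R -> functional A) (phi : functional A).
Hypothesis kms : forall beta, bv < beta -> kms_state alpha beta (phi_ beta).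
Hypothesis lim : weak_star_limit (at_right bv) phi_ phi.
Variable u : A.
Hypothesis pu : projection u.
Hypothesis phiu : phi u = 1.

(** The norm of the limit is at least 1 because the projection [u] has norm at
    most 1 and value 1. *)
Lemma kms_limit_state : state phi.
Proof.
have [lin cont cvg] := lim; split => //.
- move=> a; apply: (complex_cvg_ge0 (cvg _)); near=> b.
  have vb : bv < b by near: b; exact: nbhs_right_gt.
  by have [[_ pos _ _] _] := kms vb; exact: pos.
- move=> a; rewrite -subr_ge0.
  apply: (@complex_cvg_ge0 _ (at_right bv) _ (fun b => `|a| - `|phi_ b a|)).
    apply: (@cvgB C C^o _ _ _ (fun=> `|a|) (fun b => `|phi_ b a|)); first exact: cvg_cst.
    exact: (cvg_norm (cvg a)).
  near=> b; have vb : bv < b by near: b; exact: nbhs_right_gt.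
  by have [[_ _ bd _] _] := kms vb; rewrite subr_ge0; exact: bd.
- move=> M H; have := H u; rewrite phiu normr1 => le.
  have nu := norm_projection pu.
  have [M0|M0] := leP 0 M.
    rewrite -lecR; apply: le_trans le _; rewrite -[leRHS]mulr1.
    by apply: ler_wpM2l => //; rewrite ler0c.
  have := le_trans le (_ : _ <= 0); rewrite mulr_le0_ge0 ?normr_ge0//; last by rewrite lecR ltW.
  by move=> /(_ isT); rewrite ler10.
Unshelve. all: by end_near. Qed.

(** Both the state and the point at which the orbit is evaluated vary with
    [beta]; the states are uniformly bounded and the orbit is continuous. *)
Lemma kms_limit : kms_state alpha bv phi.
Proof.
split; first exact: kms_limit_state.
have [lin cont cvg] := lim.
move=> a F Fext b; have [Fder _] := Fext.
apply: (@complex_cvg_unique _ (at_right bv) _ (fun c => phi_ c (a ** b))); first exact: cvg.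
have Fc : (F (0 +i* c)%C : A) @[c --> bv^'+] --> F (0 +i* bv)%C.
  have Fz : {for (0 +i* bv)%C : R[i]^o, continuous F}.
    by apply: differentiable_continuous; apply/derivable1_diffP; exact: Fder.
  apply: (@cvg_comp _ _ _ (fun c : R => (0 +i* c)%C : R[i]^o) F _ _ _ _ Fz).
  apply/cvgrPdist_lt => e /complex_gt0[-> e0].
  near=> c; rewrite -Re_normc ltcR; have -> : ((0 +i* bv)%C - (0 +i* c)%C : C) = 'i%C * (bv - c)%:C%C.
    by apply/eqP; rewrite eq_complex /=; apply/andP; split; apply/eqP; ring.
  rewrite Re_normM Re_norm_i mul1r Re_norm_real.
  near: c; apply: cvgr_dist_lt e0; exact: cvg_at_right_filter.
have c1 := cvg (b ** F (0 +i* bv)%C).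
have c2 : (phi_ c (b ** F (0 +i* c)%C - b ** F (0 +i* bv)%C) : C^o) @[c --> bv^'+] --> (0 : C^o).
  apply/cvgrPdist_le => e e0; have := @cmul_contl _ _ b (F (0 +i* bv)%C).
  move=> /(cvg_comp _ _ Fc) /cvgrPdist_le /(_ e e0) H; near=> c.
  have vc : bv < c by near: c; exact: nbhs_right_gt.
  have [[_ _ bd _] _] := kms vc; rewrite sub0r normrN; apply: le_trans (bd _) _.
  by rewrite distrC; near: c; exact: H.
have c3 := cvgD c2 c1; rewrite add0r in c3.
apply: (cvg_trans _ (c3 _)); apply: near_eq_cvg; near=> c.
have vc : bv < c by near: c; exact: nbhs_right_gt.
have [[linc _ _ _] kc] := kms vc.
by rewrite (kc a F Fext) fctE (functionalB linc) subrK.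
Unshelve. all: by end_near. Qed.

End KMSLimit.

(** * The limit of the type I states *)

Section LimitState.
Variables (R : realType) (E : digraph) (A : cstar_algebra R).
Variables (p : vert E -> A) (s : edge E -> A).
Hypothesis hA : is_toeplitz_algebra p s.
Variables (alpha : R -> A -> A) (halpha : gauge_action p s alpha).
Variables (v : vert E) (hv : 0 < beta_v R v).
Variables (phi_ : R -> functional A).
Hypothesis hphi_ : forall beta : R, beta_v R v < beta ->
  type_I_state p alpha beta v (phi_ beta).
Variable phi : functional A.
Hypothesis hphi : weak_star_limit (at_right (beta_v R v)) phi_ phi.
Local Notation bv := (beta_v R v).
Local Notation V := (vert E).
Local Notation C := R[i].
Let fam : toeplitz_family p s := ta_family hA.
Let chi w : R := complex.Re (phi (p w)).

Lemma sum_projection : projection (\sum_w p w).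
Proof.
split.
  rewrite (big_morph (@star R A) (@starD R A) (@star0 R A)).
  by apply: eq_bigr => w _; exact: (star_p fam).
rewrite (big_morph (fun a => a ** _) (fun a b => cmulDl a b _) (cmul0l _)).
apply: eq_bigr => w _.
rewrite (big_morph (fun b => p w ** b) (fun a b => cmulDr (p w) a b) (cmul0r _)).
rewrite (bigD1 w)//= (p_idem fam) big1 ?addr0// => u /eqP uw.
by rewrite (tf_orth fam)// => /esym.
Qed.

Lemma limit_vertex w :
  (fine (Zwv w v beta) / fine (Zv v beta)) @[beta --> bv^'+] --> chi w.
Proof.
have [_ _ cvg] := hphi; apply: cvg_trans (Re_cvg (cvg (p w))).
apply: near_eq_cvg; near=> b; have vb : bv < b by near: b; exact: nbhs_right_gt.
by have [_ ->] := hphi_ vb.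
Unshelve. all: by end_near. Qed.

Lemma limit_vertex_real w : phi (p w) = (chi w)%:C%C.
Proof.
apply/eqP; rewrite eq_complex /= eqxx /=; apply/eqP.
have [_ _ cvg] := hphi; apply: (cvgr_unique (Im_cvg (cvg (p w)))).
apply: cvg_near_cst; near=> b; have vb : bv < b by near: b; exact: nbhs_right_gt.
by have [_ ->] := hphi_ vb.
Unshelve. all: by end_near. Qed.

(** The sum of the vertex projections has value 1 in the limit because [Z_v] is
    the sum of the [Z_{w,v}]. *)
Lemma limit_kms : kms_state alpha bv phi.
Proof.
apply: (kms_limit (phi_ := phi_) _ hphi sum_projection).
  by move=> b /hphi_[].
have [lin _ _] := hphi; rewrite (functional_sum lin).
under eq_bigr do rewrite limit_vertex_real.
by rewrite -rmorph_sum (limit_sum1 hv limit_vertex).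
Qed.

Variable psi : {set V} -> functional A.
Hypothesis hpsi : forall C, C \in pi_mc R E -> type_III_state p s alpha C (psi C).

Lemma pi_v_mc_pi_mc D : D \in pi_v_mc R v -> D \in pi_mc R E /\ beta_C R D = bv.
Proof. by rewrite finset.in_set => /andP[-> /andP[_ /eqP]]. Qed.

Lemma norm1_upset_gt0 (D : {set V}) (x : 'cV[R]_#|D|) : D \in components E -> perron_vector x ->
  0 < norm1 (upset_extension bv x).
Proof.
move=> /componentsP[w Dw] [x0 _].
have wD : w \in D by rewrite Dw mem_scc.
rewrite /norm1 (bigD1 w)//= ltr_wpDr//; first by apply: sumr_ge0.
by rewrite normr_gt0 upset_extension_C// (extend0_rank _ wD) gt_eqF.
Qed.

Lemma type_III_vertex D w : D \in pi_v_mc R v ->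
  (norm1 (chiC p phi v D))%:C%C * psi D (p w) = (chiC p phi v D w)%:C%C.
Proof.
move=> Dp; have [Dm bD] := pi_v_mc_pi_mc Dp.
have [_ _ [x [xP /=]]] := hpsi Dm; rewrite bD => -> .
have /pi_v_mcP[Dc _ _ _ _] := Dp.
have [t t0 Ht] := harmonic_perron (limit_ge0 limit_vertex)
  (limit_harmonic hv limit_vertex) Dp xP.
have cE u : chiC p phi v D u = t * upset_extension bv x u.
  by rewrite /chiC -/chi Ht upset_extensionZ.
have nE : norm1 (chiC p phi v D) = t * norm1 (upset_extension bv x).
  rewrite /norm1 mulr_sumr; apply: eq_bigr => u _.
  by rewrite cE normrM ger0_norm.
rewrite nE cE -rmorphM; congr (_%:C)%C.
by rewrite mulrACA [t * _]mulrC -mulrA; field; rewrite gt_eqF// norm1_upset_gt0.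
Qed.

Lemma limit_decomposition a :
  phi a = \sum_(D in pi_v_mc R v) (norm1 (chiC p phi v D))%:C%C * psi D a.
Proof.
pose S a := \sum_(D in pi_v_mc R v) (norm1 (chiC p phi v D))%:C%C * psi D a.
have Sc : word_kms p s bv S.
  apply: word_kms_sum => D /pi_v_mc_pi_mc[Dm bD]; apply: kms_word_kms halpha _ _ _ => //.
  by have [+ _ _] := hpsi Dm; rewrite bD.
have pc : word_kms p s bv phi by exact: kms_word_kms halpha _ _ limit_kms.
have vanish w : -1 * S (p w) + phi (p w) = 0.
  rewrite limit_vertex_real /S (eq_bigr (fun D => (chiC p phi v D w)%:C%C)).
    rewrite -rmorph_sum mulN1r; apply/eqP; rewrite addrC subr_eq0; apply/eqP; congr (_%:C)%C.
    apply: harmonic_decomposition => //.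
    - by rewrite expR_gt1.
    - exact: limit_ge0 limit_vertex.
    - exact: limit_harmonic limit_vertex.
    - exact: limit_supp limit_vertex.
  by move=> D Dp; exact: type_III_vertex.
have := word_kms_eq0 hA hv (word_kms_combine (-1) Sc pc) vanish a.
by rewrite mulN1r => /eqP; rewrite addrC subr_eq0 => /eqP.
Qed.

Lemma limit_supported : supported_on_infinite_paths p s phi.
Proof.
exists v; rewrite (_ : phi = fun a => \sum_(D in pi_v_mc R v) (norm1 (chiC p phi v D))%:C%C * psi D a); last first.
  by apply/funext => a; exact: limit_decomposition.
apply: supported_sum => D Dp; first by apply: sumr_ge0.
by have [Dm _] := pi_v_mc_pi_mc Dp; have [_ + _] := hpsi Dm; exact: supported_change_point.
Qed.

End LimitState.

Unset Implicit Arguments.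

Theorem corollary7 (R : realType) (E : digraph)
    (A : cstar_algebra R) (p : vert E -> A) (s : edge E -> A)
    (hA : is_toeplitz_algebra p s)
    (alpha : R -> A -> A) (halpha : gauge_action p s alpha)
    (v : vert E) (hv : 0 < beta_v R v)
    (phi_ : R -> functional A)
    (hphi_ : forall beta : R, beta_v R v < beta ->
       type_I_state p alpha beta v (phi_ beta))
    (phi : functional A)
    (hphi : weak_star_limit (at_right (beta_v R v)) phi_ phi)
    (psi : {set vert E} -> functional A)
    (hpsi : forall C, C \in pi_mc R E -> type_III_state p s alpha C (psi C)) :
  [/\ kms_state alpha (beta_v R v) phi /\
      supported_on_infinite_paths p s phi,
      forall a : A, phi a =
        \sum_(C in pi_v_mc R v) (norm1 (chiC p phi v C))%:C%C * psi C a &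
      forall C, C \in pi_v_mc R v -> forall w, w \in upset C ->
        (fine (ZC C w v beta) / fine (Zv v beta))
          @[beta --> at_right (beta_v R v)] --> chiC p phi v C w].
Proof.
have lim := limit_vertex hphi_ hphi.
split.
- split; first exact: (limit_kms hA hv hphi_ hphi).
  exact: (limit_supported hA halpha hv hphi_ hphi hpsi).
- exact: (limit_decomposition hA halpha hv hphi_ hphi hpsi).
- by move=> C Cp w wC; exact: (ZC_limit hv lim Cp wC).
Qed.
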